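(* Let $\lambda=(\lambda_1,\dots,\lambda_r)$ be a partition of length $r$ with a flagging $f=(f_1,\dots,f_r)$ (where, if $f_1=1$ and $r>1$, it is assumed that $f_2>1$). Then $G_{\lambda,f}$ is equal to $\pi_w(x_1^{a_1}\cdots x_r^{a_r})$, where $$a_i=\lambda_i+f_i-i\quad(i=1,\dots,r)$$ and $$w=s_rs_{r+1}\cdots s_{f_r-1}\cdot s_{r-1}s_r\cdots s_{f_{r-1}-1}\cdots s_1s_2\cdots s_{f_1-1}.$$
   Context: $x=(x_1,x_2,\dots)$ are infinitely many variables and $\beta$ is a parameter. For $h\in\mathbb{Z}[\beta][[x]]$, let $s_i(h)$ be obtained from $h$ by exchanging $x_i$ and $x_{i+1}$, and define $$\pi_i(h)=\frac{(1+\beta x_{i+1})h-(1+\beta x_i)s_i(h)}{x_i-x_{i+1}}.$$ The operators $\pi_i$ satisfy the Coxeter (braid) relations. For a permutation $w=s_{i_1}\cdots s_{i_k}$ with $\ell(w)=k$ (where $s_i$ is the transposition of $i$ and $i+1$ and $\ell$ is the length), define $\pi_w=\pi_{i_k}\cdots\pi_{i_1}$, i.e. $\pi_{i_1}$ is applied first; this is independent of the choice of reduced expression, and $\pi_{\mathrm{id}}$ is the identity. In the expression for $w$, the factor attached to the index $i$ is $s_is_{i+1}\cdots s_{f_i-1}$, which is the empty word when $f_i=i$. A partition $\lambda=(\lambda_1\ge\cdots\ge\lambda_r)$ of length $r$ is a weakly decreasing sequence of $r$ positive integers, identified with its Young diagram $\{(i,j):1\le i\le r,\ 1\le j\le\lambda_i\}$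 (English notation). A flagging of $\lambda$ is a weakly increasing sequence $f=(f_1,\dots,f_r)$ of positive integers. $FSVT(\lambda,f)$ is the set of fillings $T$ of the boxes of $\lambda$ such that the box $(i,j)$ contains a non-empty subset of $\{1,\dots,f_i\}$, and the maximum number at $(i,j)$ is at most the minimum number at $(i,j+1)$ whenever $j+1\le\lambda_i$ and strictly less than the minimum number at $(i+1,j)$ whenever $j\le\lambda_{i+1}$. The flagged Grothendieck polynomial is $$G_{\lambda,f}=G_{\lambda,f}(x)=\sum_{T\in FSVT(\lambda,f)}\beta^{|T|-|\lambda|}\prod_{k\in T}x_k,$$ where $|T|$ is the total number of entries of $T$, $|\lambda|$ is the number of boxes of $\lambda$, and the product is over all entries of $T$ (with multiplicity).
   Formalization: The flagging is assumed to satisfy f_i ≥ i for all i; otherwise the factor s_i…s_{f_i-1} is undefined, and for λ=(1,1,1), f=(2,2,2) (undefined factor read as empty) G=0 while π_1(x_1^2x_2)=x_1x_2. *)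

(* Defs.v *)
From Stdlib Require Import ClassicalEpsilon.
From HB Require Import structures.
From mathcomp Require Import all_boot all_order all_algebra.
From mathcomp Require Import finmap monalg.

Set Implicit Arguments.
Unset Strict Implicit.
Unset Printing Implicit Defensive.

Import GRing.Theory.
Local Open Scope ring_scope.

(* Indices are 0-based: [x k] is the variable x_(k+1), [s i] is the simple
   transposition s_(i+1), and the number k in a tableau stands for the entry
   k+1.  The parts of a partition and of a flagging keep their values. *)

(* Z[beta][x_1, x_2, ...]: the subring of polynomials in Z[beta][[x]]; it is
   stable under the operators pi_i. *)
Notation polyring := {malg {poly int}[{cmonom nat}]}.

HB.lock Definition beta : polyring := ('X : {poly int})%:MP.

HB.lock Definition x (k : nat) : polyring := << ucm k >>.

Definition s (i k : nat) : nat :=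
  if k == i then i.+1 else if k == i.+1 then i else k.

Definition swap_monom (i : nat) (m : {cmonom nat}) : polyring :=
  \prod_(k <- finsupp m) x (s i k) ^+ m k.

Definition swap (i : nat) (h : polyring) : polyring :=
  mmap (@mkmalgU {cmonom nat} {poly int} mone) (swap_monom i) h.

(* The quotient below is exact and unique: see [pi_spec] and [pi_uniq]. *)
Definition is_pi (i : nat) (h g : polyring) : Prop :=
  (x i - x i.+1) * g =
  (1 + beta * x i.+1) * h - (1 + beta * x i) * swap i h.

Definition pi (i : nat) (h : polyring) : polyring :=
  epsilon (inhabits 0) (is_pi i h).

(* [pi_word [:: i_1; ...; i_k]] is pi_(i_k) ... pi_(i_1). *)
Definition pi_word (ws : seq nat) (h : polyring) : polyring :=
  foldl (fun g i => pi i g) h ws.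

(* [word_perm [:: i_1; ...; i_k]] is the product s_(i_1) ... s_(i_k). *)
Definition word_perm (ws : seq nat) : nat -> nat :=
  foldr (fun i w => s i \o w) id ws.

Definition reduced_word (w : nat -> nat) (ws : seq nat) : Prop :=
  word_perm ws =1 w /\
  forall ws', word_perm ws' =1 w -> (size ws <= size ws')%N.

(* pi_w is computed on an unspecified reduced word of w; it is only meaningful
   for a permutation w moving finitely many points. *)
Definition pi_perm (w : nat -> nat) (h : polyring) : polyring :=
  pi_word (epsilon (inhabits [::]) (reduced_word w)) h.

Lemma reduced_word_exists ws : exists ws', reduced_word (word_perm ws) ws'.
Proof.
have [n] := ubnP (size ws); elim: n ws => // n IHn ws ltn.
have [[ws' [eqw lt_ws]]|no] := excluded_middle_informative
  (exists ws', word_perm ws' =1 word_perm ws /\ (size ws' < size ws)%N).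
  have [ws'' [eqw'' min]] := IHn ws' (leq_trans lt_ws ltn).
  exists ws''; split=> [k|v eqv]; first by rewrite eqw'' eqw.
  by apply: min => k; rewrite eqv eqw.
exists ws; split=> // v eqv; rewrite leqNgt; apply/negP => lt_v.
by case: no; exists v.
Qed.

Definition is_partition (la : seq nat) : bool :=
  sorted geq la && all (ltn 0) la.

Definition is_flagging (la f : seq nat) : bool :=
  [&& size f == size la, sorted leq f & all (ltn 0) f].

Definition box (la : seq nat) : finType :=
  {i : 'I_(size la) & 'I_(nth 0%N la i)}.

Definition row {la : seq nat} (b : box la) : nat := tag b.
Definition col {la : seq nat} (b : box la) : nat := tagged b.

Definition maxentry (f : seq nat) : nat := \max_(k <- f) k.

Definition filling (la f : seq nat) : finType :=
  {ffun box la -> {set 'I_(maxentry f)}}.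

(* On the empty set, these take the junk values 0 and n. *)
Definition setmax (n : nat) (A : {set 'I_n}) : nat :=
  \max_(k in A) (k : nat).
Definition setmin (n : nat) (A : {set 'I_n}) : nat :=
  \big[minn/n]_(k in A) (k : nat).

Definition is_FSVT (la f : seq nat) (T : filling la f) : bool :=
  [&& [forall b, T b != set0],
      [forall b, forall k in T b, (k < nth 0 f (row b))%N],
      [forall b, forall b', (row b' == row b) && (col b' == (col b).+1) ==>
         (setmax (T b) <= setmin (T b'))%N]
    & [forall b, forall b', (row b' == (row b).+1) && (col b' == col b) ==>
         (setmax (T b) < setmin (T b'))%N]].

Definition G (la f : seq nat) : polyring :=
  \sum_(T : filling la f | is_FSVT T)
     beta ^+ (\sum_b #|T b| - sumn la) * \prod_b \prod_(k in T b) x k.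

(* The word s_r ... s_(f_r - 1) . s_(r-1) ... s_(f_(r-1) - 1) ... s_1 ...
   s_(f_1 - 1); with 0-based indices, row i contributes i, ..., f_i - 2. *)
Definition flag_word (f : seq nat) : seq nat :=
  flatten [seq iota i (nth 0%N f i - i.+1) | i <- rev (iota 0 (size f))].

Lemma swap_monom_is_mmorphism i : mmorphism (swap_monom i).
Proof.
have wid (m : {cmonom nat}) (d : {fset nat}) : (finsupp m `<=` d)%fset ->
    swap_monom i m = \prod_(k <- d) x (s i k) ^+ m k.
  move=> le; apply: big_fset_incl => // k kd.
  by rewrite -cmE_eq0 => /eqP ->.
split=> [m1 m2|]; last by rewrite /swap_monom mdom1 big_seq_fset0.
rewrite (wid _ _ (fsubset_refl _)) (wid m1 (finsupp (mmul m1 m2))).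
  rewrite (wid m2 (finsupp (mmul m1 m2))).
    by rewrite -big_split /=; apply: eq_bigr => k _; rewrite cmM exprD.
  by rewrite mdomD fsubsetUr.
by rewrite mdomD fsubsetUl.
Qed.

HB.instance Definition _ i :=
  isMultiplicative.Build {cmonom nat} polyring (swap_monom i)
    (swap_monom_is_mmorphism i).

HB.instance Definition _ i := GRing.RMorphism.copy (swap i)
  (mmap (@mkmalgU {cmonom nat} {poly int} mone) (swap_monom i)).

Lemma swapX i k : swap i (x k) = x (s i k).
Proof.
rewrite /swap {1}x.unlock mmapU /swap_monom mdomU big_seq_fset1.
by rewrite cmUU expr1 mul1r.
Qed.

Lemma swapC i c : swap i c%:MP = c%:MP.
Proof. by rewrite /swap mmapC. Qed.

Lemma malgUM (m1 m2 : {cmonom nat}) :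
  << mmul m1 m2 >> = << m1 >> * << m2 >> :> polyring.
Proof. by rewrite malgM_def fgmulUU mulr1. Qed.

Lemma cmonomD (k : nat) (m : {cmonom nat}) :
  (0 < m k)%N -> m = mmul (ucm k) (divcm m (ucm k)).
Proof.
move=> mk; apply/eqP/cmP => j; rewrite cmM cmU divcmE ucmE.
by case: eqP => [<-|_]; rewrite ?subn0 // subnKC.
Qed.

Lemma malg_ind (P : polyring -> Prop) :
    (forall c, P c%:MP) -> (forall k, P (x k)) ->
    (forall g h, P g -> P h -> P (g + h)) ->
    (forall g h, P g -> P h -> P (g * h)) ->
  forall g, P g.
Proof.
move=> PC PX PD PM g; rewrite (monalgE g).
apply: (big_ind P) => // [|m _]; first by rewrite -malgC0E.
have -> : << g@_m *g m >> = (g@_m)%:MP * << m >> :> polyring.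
  by rewrite malgM_def fgmulUU mulr1 mul1m.
apply: (PM) => //; have [n] := ubnP (mdeg m); elim: n m => // n IHn m ltm.
have [->|m1] := eqVneq m mone; first exact: PC.
have /fset0Pn [k] : finsupp m != fset0.
  apply: contraNneq m1 => m0; rewrite -mdeg_eq0 mdegE m0.
  by rewrite big_seq_fset0.
rewrite -cmE_neq0 -lt0n => mk; rewrite (cmonomD mk) malgUM.
apply: (PM); first by have := PX k; rewrite x.unlock.
apply: IHn; move: ltm; rewrite {1}(cmonomD mk) mdegM mdegU.
by rewrite add1n ltnS.
Qed.

Lemma sub_swap_dvd i h : exists g, (x i - x i.+1) * g = h - swap i h.
Proof.
elim/malg_ind: h => [c|k|g h [p Ep] [q Eq]|g h [p Ep] [q Eq]].
- by exists 0; rewrite swapC mulr0 subrr.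
- rewrite swapX /s; case: eqP => [->|_]; first by exists 1; rewrite mulr1.
  case: eqP => [->|_]; last by exists 0; rewrite mulr0 subrr.
  by exists (- 1); rewrite mulrN1 opprB.
- by exists (p + q); rewrite mulrDr Ep Eq rmorphD /= opprD addrACA.
have leibniz (A : comNzRingType) (d u v a sa b sb : A) :
    d * u = a - sa -> d * v = b - sb -> d * (u * b + sa * v) = a * b - sa * sb.
  by move=> Eu Ev; rewrite mulrDr mulrA Eu mulrCA Ev mulrBl mulrBr addrA subrK.
exists (p * h + swap i g * q).
have swapM : swap i (g * h) = swap i g * swap i h by exact: rmorphM.
rewrite swapM.
exact: (@leibniz polyring _ _ _ _ _ _ _ Ep Eq).
Qed.

Lemma pi_exists i h : exists g, is_pi i h g.
Proof.
have [g Eg] := sub_swap_dvd i ((1 + beta * x i.+1) * h).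
have swapE : swap i ((1 + beta * x i.+1) * h) = (1 + beta * x i) * swap i h.
  have swapM u v : swap i (u * v) = swap i u * swap i v by exact: rmorphM.
  have swapD u v : swap i (u + v) = swap i u + swap i v by exact: rmorphD.
  have swap1 : swap i 1 = 1 by exact: rmorph1.
  have swapb : swap i beta = beta by rewrite beta.unlock; exact: swapC.
  have swapx : swap i (x i.+1) = x i.
    have sK : s i i.+1 = i by rewrite /s eqxx gtn_eqF.
    by rewrite swapX sK.
  by rewrite swapM swapD swapM swap1 swapb swapx.
by exists g; rewrite /is_pi Eg swapE.
Qed.

Lemma pi_spec i h : is_pi i h (pi i h).
Proof. exact: epsilon_spec (pi_exists i h). Qed.

Lemma mcoeffXM k g m :
  (x k * g)@_m = if m k is 0%N then 0 else g@_(divcm m (ucm k)).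
Proof.
rewrite x.unlock {1}(monalgE g) mulr_sumr raddf_sum /=.
under eq_bigr => j _ do rewrite malgM_def fgmulUU mul1r mcoeffU.
case mk: (m k) => [|a].
  rewrite big1_seq // => j _; case: eqP => // /(congr1 (fun u : cmonom nat => u k)).
  by rewrite cmM cmUU mk.
have Em := @cmonomD k m; rewrite mk in Em; move/(_ isT) in Em.
have inj (j : {cmonom nat}) :
    (mmul (ucm k) j == m) = (j == divcm m (ucm k)).
  apply/eqP/eqP => [<-|->]; last by rewrite -Em.
  by apply/eqP/cmP => l; rewrite divcmE cmM ucmE addKn.
under eq_bigr => j _ do rewrite inj.
have [in_g|] := boolP (divcm m (ucm k) \in msupp g).
  rewrite (big_fsetD1 _ in_g) /= eqxx mulr1n big1_fset ?addr0 // => j.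
  by rewrite !inE => /andP [/negPf ->].
move=> nin; rewrite mcoeff_outdom // big1_seq // => j /andP [_ jg].
by case: eqP => // jE; rewrite -jE jg in nin.
Qed.

Lemma subX_reg i g : (x i - x i.+1) * g = 0 -> g = 0.
Proof.
move/eqP; rewrite mulrBl subr_eq0 => /eqP E.
have ne : (i == i.+1) = false by apply/eqP => /n_Sn.
have XM k m : (x k * g)@_(mmul (ucm k) m) = g@_m.
  rewrite (mcoeffXM k g (mmul (ucm k) m)) cmM cmUU add1n.
  congr (mcoeff _ g); apply/eqP/cmP => l.
  by rewrite divcmE cmM ucmE addKn.
apply/malgP => m; rewrite mcoeff0.
move: {2}(m i.+1) (erefl (m i.+1)) => n; elim: n m => [|n IHn] m mi.
  rewrite -(XM i m) E (mcoeffXM i.+1 g (mmul (ucm i) m)).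
  by rewrite cmM cmU ne mi.
have mE := @cmonomD i.+1 (mmul (ucm i) m).
rewrite -(XM i m) E mE ?XM; last by rewrite cmM cmU ne mi.
by apply: IHn; rewrite divcmE cmM !cmU ne eqxx mi add0n subn1.
Qed.

Lemma pi_uniq i h g : is_pi i h g -> g = pi i h.
Proof.
move=> Eg; apply/eqP; rewrite -subr_eq0; apply/eqP/(@subX_reg i).
by rewrite mulrBr Eg (pi_spec i h); exact: subrr.
Qed.

(* Main.v *)
Require Import Defs.
From Stdlib Require Import FunctionalExtensionality ClassicalEpsilon.
From HB Require Import structures.
From mathcomp Require Import all_boot all_order all_algebra.
From mathcomp Require Import finmap monalg ring zify.

(* A set-valued tableau is determined by its filling t by box minima and by the
   other entries, and the latter can be chosen independently in each box: k may
   be added to the box (i, j) when t(i, j) < k < t(i + 1, j), k <= t(i, j + 1)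
   and k <= f_i.  Recording in row i how many boxes of t are < m turns t into a
   chain of partitions, one for each m, so that G is a sum over chains of a
   product of local weights, with one factor 1 + beta x_m for each removable
   corner that m may share.

   The main step (after Wachs) is that, for lambda_1 > lambda_2 and
   k = f_1 < f_2, pi_k turns the polynomial of lambda with flag f into that of
   (lambda_1 - 1, lambda_2, ...) with flag (f_1 + 1, f_2, ...).  Fix all
   partitions of the chain except the one between the letters k and k + 1: its
   parts vary independently, and up to a symmetric function of x_k, x_(k+1) the rows below the first
   contribute only a boundary factor towards the first row, so that a one-row
   identity is left.  Iterating brings f_1 down to 1; then the first row is
   constant and factors out as a power of x_1, and one goes on with the other
   rows and the variables x_2, x_3, ...

   The word obtained is a concatenation of increasing runs.  Braid relations and
   cancellations s_i s_i = 1 bring every word to such a concatenation, which is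
   determined by its permutation.  A reduced word needs no cancellation, hence
   all reduced words of w give the same operator as the given word. *)

Import GRing.Theory.
Local Open Scope ring_scope.

(* mathcomp has its own pi, row and col. *)
Import Defs.

Set Implicit Arguments.
Unset Strict Implicit.
Unset Printing Implicit Defensive.

(** * Finite families extended to sequences *)

Definition fcons (T : Type) (a : T) (g : nat -> T) (i : nat) : T :=
  if i is j.+1 then g j else a.

Definition fun_ext (T : Type) n (d : T) (v : 'I_n -> T) (i : nat) : T :=
  if insub i is Some j then v j else d.

Lemma fun_ext_in (T : Type) n (d : T) (v : 'I_n -> T) (i : 'I_n) :
  fun_ext d v i = v i.
Proof. by rewrite /fun_ext valK. Qed.

Lemma fun_ext_lt (T : Type) n (d : T) (v : 'I_n -> T) i (lt_i : (i < n)%N) :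
  fun_ext d v i = v (Ordinal lt_i).
Proof. by rewrite -(fun_ext_in d v (Ordinal lt_i)). Qed.

Lemma fun_ext_out (T : Type) n (d : T) (v : 'I_n -> T) i :
  (n <= i)%N -> fun_ext d v i = d.
Proof. by move=> le_i; rewrite /fun_ext insubF // ltnNge le_i. Qed.

Definition ffun_insert (Y : Type) n (k : 'I_n.+1) (y : Y)
    (g : {ffun 'I_n -> Y}) : {ffun 'I_n.+1 -> Y} :=
  [ffun i => if unlift k i is Some j then g j else y].

Lemma sum_ffun_insert (A : nmodType) (Y : finType) n (k : 'I_n.+1)
    (F : {ffun 'I_n.+1 -> Y} -> A) :
  \sum_g F g = \sum_y \sum_g F (ffun_insert k y g).
Proof.
rewrite pair_big /=.
pose h (p : Y * {ffun 'I_n -> Y}) := ffun_insert k p.1 p.2.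
pose h' (g : {ffun 'I_n.+1 -> Y}) := (g k, [ffun j => g (lift k j)]).
rewrite (reindex h) //; exists h' => [[y g] _|g _].
  rewrite /h /h' /ffun_insert /= ffunE unlift_none; congr pair.
  by apply/ffunP => j; rewrite !ffunE liftK.
apply/ffunP => i; rewrite ffunE /=.
by case: unliftP => [j ->|->]; rewrite ?ffunE.
Qed.

(** * Chain sums and the one-step recursion on the first flag *)

Section Transfer.

Variables (A : comNzRingType) (b : A) (N : nat).

Definition shape_of r (v : {ffun 'I_r -> 'I_N}) (i : nat) : nat :=
  fun_ext 0%N (fun j => v j : nat) i.

(** The sum runs over all tuples of parts below [N]; inadmissible shapes are killed by the weights,
    so no partition condition has to be carried along. *)
Definition shape_sum r (F : (nat -> nat) -> A) : A :=
  \sum_(v : {ffun 'I_r -> 'I_N}) F (shape_of v).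

Lemma shape_of0 (v : {ffun 'I_0 -> 'I_N}) : shape_of v = fun=> 0%N.
Proof. by apply: functional_extensionality => i; exact: fun_ext_out. Qed.

Lemma shape_sum0 F : shape_sum 0 F = F (fun=> 0%N).
Proof.
rewrite /shape_sum; under eq_bigr do rewrite shape_of0.
by rewrite sumr_const card_ffun !card_ord expn0.
Qed.

Lemma shape_sumS r F :
  shape_sum r.+1 F = \sum_(n < N) shape_sum r (fun g => F (fcons (n : nat) g)).
Proof.
rewrite /shape_sum (sum_ffun_insert ord0); apply: eq_bigr => n _.
apply: eq_bigr => g _; congr F; apply: functional_extensionality => -[|i].
  rewrite /shape_of (fun_ext_lt _ _ (ltn0Sn r)) /= ffunE.
  by rewrite (_ : Ordinal _ = ord0) ?unlift_none //; apply: val_inj.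
have [lt_i|le_i] := ltnP i r; last by rewrite /= /shape_of !fun_ext_out.
rewrite /= /shape_of (fun_ext_lt _ _ lt_i) (fun_ext_lt _ _ (lt_i : (i.+1 < r.+1)%N)).
rewrite ffunE (_ : Ordinal _ = lift ord0 (Ordinal lt_i)) ?liftK //.
exact: val_inj.
Qed.

(* Weight of the letter m in one row of a chain: the row grows from n to p boxes
   and the next row has q boxes afterwards.  The last box of length n may also
   receive m if nothing lies below it, and m is allowed only below the flag F. *)
Definition step_weight (X : nat -> A) (F m n p q : nat) : A :=
  if [&& (q <= n)%N, (n <= p)%N & (m < F)%N || (n == p)] then
    X m ^+ (p - n) * (if (m < F)%N && (q < n)%N then 1 + b * X m else 1)
  else 0.

(** [mu] is the shape formed by the letters below [m], and the recursion strips the largest of them.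
    The interlacing [mu (i + 1) <= nu i <= mu i] is enforced by [step_weight]. *)
Fixpoint chain_sum (X : nat -> A) r (f : nat -> nat) (m : nat) (mu : nat -> nat) : A :=
  if m is m'.+1 then
    shape_sum r (fun nu =>
      (\prod_(i < r) step_weight X (f i) m' (nu i) (mu i) (mu i.+1)) *
      chain_sum X r f m' nu)
  else \prod_(i < r) (mu i == 0%N)%:R.

Definition strip_weight (x : A) (n p : nat) : A :=
  if (n <= p)%N then x ^+ (p - n) else 0.

Definition corner_weight (x : A) (n q : nat) : A :=
  if (q <= n)%N then (if (q < n)%N then 1 + b * x else 1) else 0.

(** For an allowed letter the dependence on [p] separates from that on [q], so the corner factor of
    a row can be moved to the row below, whose length it involves. *)
Lemma step_weight_open X F m n p q :
  (m < F)%N -> step_weight X F m n p q = strip_weight (X m) n p * corner_weight (X m) n q.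
Proof.
move=> lt_m; rewrite /step_weight /strip_weight /corner_weight lt_m /= andbT.
by case: (q <= n)%N; case: (n <= p)%N; rewrite ?mulr0 ?mul0r.
Qed.

Lemma step_weight_closed X F m n p q : (F <= m)%N ->
  step_weight X F m n p q = if (n == p) && (q <= n)%N then 1 else 0.
Proof.
move=> le_F; rewrite /step_weight ltnNge le_F /= andbC.
case: eqP => [->|_]; last by rewrite andbF.
by rewrite leqnn subnn expr0 mul1r andbT.
Qed.

Lemma sum_window lo d (g : nat -> A) : (lo + d < N)%N ->
  (\sum_(n < N) if (lo <= n <= lo + d)%N then g (n - lo)%N else 0) =
  \sum_(j < d.+1) g j.
Proof.
move=> lt_N; rewrite -(big_mkord xpredT
  (fun n => if (lo <= n <= lo + d)%N then g (n - lo)%N else 0)).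
rewrite (@big_cat_nat _ _ _ lo) //=; try lia.
rewrite (@big_cat_nat _ _ _ (lo + d.+1) lo) //=; try lia.
rewrite big_nat big1 => [|n]; last by case: ifP => //; lia.
rewrite [X in _ + (_ + X)]big_nat [X in _ + (_ + X)]big1 => [|n]; last first.
  by case: ifP => //; lia.
rewrite add0r addr0 -{1}[lo]add0n big_addn addKn big_mkord.
apply: eq_bigr => j _; have := ltn_ord j.
by rewrite addnK; case: ifP => // *; lia.
Qed.

(* The boundary factors [1 + b x], [1 + b y] are missing at the ends of the
   range of summation that are attained. *)
Definition core (x y : A) d (e e' : bool) : A :=
  \sum_(j < d.+1) x ^+ j * y ^+ (d - j) *
    (if e && (j < d)%N then 1 + b * x else 1) *
    (if e' && (0 < j)%N then 1 + b * y else 1).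

(** An extra [b * x] at index [j] gives the same monomial as an extra [b * y] at index [j + 1], so
    both one-sided sums are [h + h']. *)
Lemma coreC x y d e e' : core x y d e e' = core x y d e' e.
Proof.
suff E : core x y d true false = core x y d false true by case: e; case: e'.
pose h := \sum_(j < d.+1) x ^+ j * y ^+ (d - j).
pose h' := \sum_(j < d) b * x ^+ j.+1 * y ^+ (d - j).
have lE : core x y d true false = h + h'.
  rewrite /core /h /h' 2!big_ord_recr /= ltnn !mulr1 addrAC -big_split /=.
  congr (_ + _); apply: eq_bigr => j _; rewrite ltn_ord exprS; ring.
have rE : core x y d false true = h + h'.
  rewrite /core /h /h' 2!big_ord_recl /= !mulr1 -addrA -big_split /=.
  congr (_ + _); apply: eq_bigr => j _; rewrite /bump !add1n /=.
  have -> : (d - j = (d - j.+1).+1)%N by have := ltn_ord j; lia.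
  by rewrite !exprS; ring.
by rewrite lE rE.
Qed.

Lemma core_mul_sub x y d :
  (x - y) * core x y d false false = x ^+ d.+1 - y ^+ d.+1.
Proof.
rewrite subrXX [in RHS](reindex_inj rev_ord_inj) /=; congr (_ * _).
apply: eq_bigr => j _; rewrite !mulr1 subSS; congr (_ ^+ _ * _).
by have := ltn_ord j; lia.
Qed.

Lemma core_true x y d :
  core x y d false true = (1 + b * y) * core x y d false false - b * y ^+ d.+1.
Proof.
rewrite /core !big_ord_recl /= !mulr1 mulrDr mulr_sumr !expr0 !mul1r subn0.
rewrite [X in X + _ - _]mulrDl mul1r [y ^+ d.+1]exprS mulrA addrAC addrK.
by congr (_ + _); apply: eq_bigr => j _; rewrite !mulr1 mulrC.
Qed.

Section Symmetrize.

Variables (s : {rmorphism A -> A}) (x y : A).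
Hypotheses (sb : s b = b) (sx : s x = y) (sy : s y = x).

(** The relation between [h] and its image, with the denominator cleared; [s] plays the role of the
    exchange in an arbitrary commutative ring. *)
Definition isPi (h g : A) : Prop :=
  (x - y) * g = (1 + b * y) * h - (1 + b * x) * s h.

Lemma isPi0 : isPi 0 0.
Proof. by rewrite /isPi rmorph0 !mulr0 subrr. Qed.

Lemma isPiD h h' g g' : isPi h g -> isPi h' g' -> isPi (h + h') (g + g').
Proof.
rewrite /isPi => E E'; rewrite mulrDr E E' rmorphD /=; ring.
Qed.

Lemma isPi_sum (I : Type) (r : seq I) (h g : I -> A) :
  (forall i, isPi (h i) (g i)) -> isPi (\sum_(i <- r) h i) (\sum_(i <- r) g i).
Proof.
by move=> E; apply: (big_rec2 isPi isPi0) => i u v _; apply: isPiD.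
Qed.

Lemma isPiM c h g : s c = c -> isPi h g -> isPi (c * h) (c * g).
Proof. by rewrite /isPi => Ec E; rewrite mulrCA E rmorphM /= Ec; ring. Qed.

(** [s] reverses the summation and exchanges the two boundary conditions, which [coreC] makes
    harmless. *)
Lemma s_core d e e' : s (core x y d e e') = core x y d e e'.
Proof.
rewrite [RHS]coreC /core rmorph_sum [RHS](reindex_inj rev_ord_inj) /=.
have sif (t : bool) z : s (if t then 1 + b * z else 1) =
    if t then 1 + b * s z else 1.
  by case: t; rewrite ?rmorphD ?rmorphM rmorph1 ?sb.
apply: eq_bigr => j _; rewrite !rmorphM !rmorphXn /= !sif sx sy subSS.
have -> : (d - (d - j) = j)%N by have := ltn_ord j; lia.
have -> : (d - j < d)%N = (0 < j)%N by have := ltn_ord j; lia.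
have -> : (0 < d - j)%N = (j < d)%N by have := ltn_ord j; lia.
by rewrite [y ^+ _ * _]mulrC mulrAC.
Qed.

(** This and the next two lemmas evaluate the operator on what is left of the first row in the three
    cases of [isPi_two_steps]. *)
Lemma isPi_exp d : isPi (x ^+ d.+1) (core x y d false true).
Proof.
rewrite /isPi core_true mulrBr mulrCA core_mul_sub rmorphXn /= sx; ring.
Qed.

Lemma isPi_exp1 d : isPi ((1 + b * x) * x ^+ d.+1)
  ((1 + b * x) * (1 + b * y) * core x y d false false).
Proof.
rewrite /isPi mulrCA core_mul_sub rmorphM rmorphXn rmorphD rmorphM rmorph1 /=.
by rewrite sx sb; ring.
Qed.

Lemma isPi_1x : isPi (1 + b * x) 0.
Proof. by rewrite /isPi rmorphD rmorphM rmorph1 /= sb sx mulr0; ring. Qed.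

End Symmetrize.

(** [n] is the length of a row between the letters of [x] and [y], and [a] the earlier length of the
    row above. If [a <= p0], the factor [1 + b * x] is missing exactly at [n = hi = a]; otherwise it
    occurs throughout and comes out of the sum. The same alternative governs [1 + b * y] at [lo]. *)
Lemma row_sum x y a n0 p0 p1 (lo := maxn n0 p1) (hi := minn a p0) :
  (p0 < N)%N ->
  \sum_(n < N) corner_weight x a n *
    (strip_weight x n0 n * strip_weight y n p0 * corner_weight y n p1) =
  if (lo <= hi)%N then
    x ^+ (lo - n0) * y ^+ (p0 - hi) * (if (a <= p0)%N then 1 else 1 + b * x) *
    (if (n0 <= p1)%N then 1 else 1 + b * y) *
    core x y (hi - lo) (a <= p0)%N (n0 <= p1)%N
  else 0.
Proof.
move=> lt_N; have [le_lh|lt_hl] := leqP lo hi; last first.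
  apply: big1 => n _; rewrite /corner_weight /strip_weight.
  case: (leqP n a) => h1; last by rewrite mul0r.
  case: (leqP n0 n) => h2; last by rewrite !mul0r mulr0.
  case: (leqP n p0) => h3; last by rewrite mulr0 mul0r mulr0.
  case: (leqP p1 n) => h4; last by rewrite !mulr0.
  by move: lt_hl; rewrite /lo /hi; lia.
rewrite /core mulr_sumr; set K := _ * (if (n0 <= p1)%N then 1 else 1 + b * y).
rewrite -(@sum_window lo _ (fun j => K * (x ^+ j * y ^+ (hi - lo - j) *
  (if (a <= p0)%N && (j < hi - lo)%N then 1 + b * x else 1) *
  (if (n0 <= p1)%N && (0 < j)%N then 1 + b * y else 1)))); last first.
  by rewrite /hi in le_lh *; lia.
rewrite {}/K.
apply: eq_bigr => n _; rewrite (subnKC le_lh).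
have -> : (lo <= n <= hi)%N = [&& n <= a, n0 <= n, n <= p0 & p1 <= n]%N.
  by rewrite /lo /hi; lia.
rewrite /corner_weight /strip_weight.
case: (leqP n a) => h1 /=; last by rewrite mul0r.
case: (leqP n0 n) => h2 /=; last by rewrite !mul0r mulr0.
case: (leqP n p0) => h3 /=; last by rewrite mulr0 mul0r mulr0.
case: (leqP p1 n) => h4 /=; last by rewrite !mulr0.
have -> : (n - n0 = (lo - n0) + (n - lo))%N by rewrite /lo; lia.
have -> : (p0 - n = (p0 - hi) + (hi - lo - (n - lo)))%N by rewrite /lo /hi; lia.
rewrite !exprD; set X1 := x ^+ _; set X2 := x ^+ _; set Y1 := y ^+ _.
set Y2 := y ^+ _.
have -> : (n - lo < hi - lo)%N = (n < hi)%N by rewrite /lo /hi; lia.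
have -> : (0 < n - lo)%N = (lo < n)%N by rewrite /lo; lia.
case: (leqP a p0) => ha /=; case: (leqP n0 p1) => hp /=.
- have -> : hi = a by rewrite /lo /hi; lia.
  have -> : lo = p1 by rewrite /lo /hi; lia.
  by ring.
- have -> : hi = a by rewrite /lo /hi; lia.
  have -> : (p1 < n)%N = true by rewrite /lo /hi; lia.
  by ring.
- have -> : (n < a)%N = true by rewrite /lo /hi; lia.
  have -> : lo = p1 by rewrite /lo /hi; lia.
  by ring.
- have -> : (n < a)%N = true by rewrite /lo /hi; lia.
  have -> : (p1 < n)%N = true by rewrite /lo /hi; lia.
  by ring.
Qed.

Lemma top_row_sum x y n0 p0 p1 (lo := maxn n0 p1) : (p0 < N)%N ->
  \sum_(n < N) strip_weight x n0 n * strip_weight y n p0 * corner_weight y n p1 =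
  if (lo <= p0)%N then
    x ^+ (lo - n0) * (if (n0 <= p1)%N then 1 else 1 + b * y) *
    core x y (p0 - lo) false (n0 <= p1)%N
  else 0.
Proof.
move=> lt_N; have [le_lh|lt_hl] := leqP lo p0; last first.
  apply: big1 => n _; rewrite /corner_weight /strip_weight.
  case: (leqP n0 n) => h2; last by rewrite !mul0r.
  case: (leqP n p0) => h3; last by rewrite mulr0 mul0r.
  case: (leqP p1 n) => h4; last by rewrite !mulr0.
  by move: lt_hl; rewrite /lo; lia.
rewrite /core mulr_sumr; set K := _ * (if (n0 <= p1)%N then 1 else 1 + b * y).
rewrite -(@sum_window lo _ (fun j => K * (x ^+ j * y ^+ (p0 - lo - j) *
  (if false && (j < p0 - lo)%N then 1 + b * x else 1) *
  (if (n0 <= p1)%N && (0 < j)%N then 1 + b * y else 1)))); last by lia.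
rewrite {}/K.
apply: eq_bigr => n _; rewrite (subnKC le_lh).
have -> : (lo <= n <= p0)%N = [&& n0 <= n, n <= p0 & p1 <= n]%N.
  by rewrite /lo; lia.
rewrite /corner_weight /strip_weight.
case: (leqP n0 n) => h2 /=; last by rewrite !mul0r.
case: (leqP n p0) => h3 /=; last by rewrite mulr0 mul0r.
case: (leqP p1 n) => h4 /=; last by rewrite !mulr0.
have -> : (n - n0 = (lo - n0) + (n - lo))%N by rewrite /lo; lia.
have -> : (p0 - n = p0 - lo - (n - lo))%N by rewrite /lo; lia.
rewrite !exprD; set X1 := x ^+ _; set X2 := x ^+ _; set Y1 := y ^+ _.
have -> : (0 < n - lo)%N = (lo < n)%N by rewrite /lo; lia.
case: (leqP n0 p1) => hp /=.
- have -> : lo = p1 by rewrite /lo; lia.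
  by ring.
- have -> : (p1 < n)%N = true by rewrite /lo; lia.
  by ring.
Qed.

(* The boundary factor left by the rows below a row of length a, when the
   topmost of them has length p. *)
Definition edge (x y : A) (p a : nat) : A :=
  if (a <= p)%N then y ^+ (p - a) else 1 + b * x.

(* The letters of x, then y, lead from nu to mu in the rows below a row whose
   length before these letters is a. *)
Definition lower_rows x y r a (nu mu : nat -> nat) : A :=
  shape_sum r (fun rho => corner_weight x a (rho 0) *
    \prod_(i < r) (strip_weight x (nu i) (rho i) * corner_weight x (nu i) (rho i.+1) *
                   (strip_weight y (rho i) (mu i) * corner_weight y (rho i) (mu i.+1)))).

(** The factor joining two consecutive rows compares the summed length [rho (i + 1)] with the fixed
    length [nu i]; hence the sum splits row by row. *)
Lemma lower_rowsS x y r a nu mu :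
  lower_rows x y r.+1 a nu mu =
  (\sum_(n < N) corner_weight x a n *
     (strip_weight x (nu 0) n * strip_weight y n (mu 0) * corner_weight y n (mu 1))) *
    lower_rows x y r (nu 0) (nu \o S) (mu \o S).
Proof.
rewrite /lower_rows shape_sumS mulr_suml; apply: eq_bigr => n _.
rewrite /shape_sum mulr_sumr; apply: eq_bigr => v _; rewrite big_ord_recl /=.
by set P := \prod_(i < r) _; ring.
Qed.

Section LowerRows.

Variables (s : {rmorphism A -> A}) (x y : A).
Hypotheses (sb : s b = b) (sx : s x = y) (sy : s y = x).

(** Induction on the number of rows: the edge factor of the remaining rows completes the prefactor
    of [row_sum] at its lower end to a symmetric one, and the prefactor at the upper end becomes the
    new edge. *)
Lemma lower_rows_edge r a nu mu : mu r = 0%N ->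
  (forall i, (mu i < N)%N) ->
  exists2 S, s S = S & lower_rows x y r a nu mu = edge x y (mu 0) a * S.
Proof.
elim: r a nu mu => [|r IHr] a nu mu mu_r lt_N.
  exists 1; rewrite ?rmorph1 // mulr1 /lower_rows shape_sum0 big_ord0 mulr1.
  rewrite mu_r /edge /corner_weight leqn0 lt0n; case: eqP => [->|] //=.
rewrite lower_rowsS.
have [S' sS' ->] := IHr (nu 0) (nu \o succn) (mu \o succn) mu_r (fun i => lt_N i.+1).
rewrite row_sum //=; case: ifP => le_lh; last first.
  by exists 0; rewrite ?rmorph0 ?mul0r ?mulr0.
set hi := minn a (mu 0); set lo := maxn (nu 0) (mu 1).
exists (core x y (hi - lo) (a <= mu 0)%N (nu 0 <= mu 1)%N *
  (if (nu 0 <= mu 1)%N then (x * y) ^+ (mu 1 - nu 0)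
   else (1 + b * x) * (1 + b * y)) * S').
  rewrite !rmorphM /= sS' (s_core sb sx sy); congr (_ * _ * _).
  case: ifP => _; first by rewrite rmorphXn rmorphM sx sy mulrC.
  by rewrite rmorphM !rmorphD !rmorphM rmorph1 sb sx sy mulrC.
rewrite /edge; case: (leqP a (mu 0)) => ha; case: (leqP (nu 0) (mu 1)) => hp.
- have -> : hi = a by rewrite /lo /hi; lia.
  have -> : lo = mu 1 by rewrite /lo /hi; lia.
  by rewrite exprMn; ring.
- have -> : hi = a by rewrite /lo /hi; lia.
  have -> : lo = nu 0 by rewrite /lo /hi; lia.
  by rewrite subnn expr0; ring.
- have -> : hi = mu 0 by rewrite /lo /hi; lia.
  have -> : lo = mu 1 by rewrite /lo /hi; lia.
  by rewrite subnn expr0 exprMn; ring.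
- have -> : hi = mu 0 by rewrite /lo /hi; lia.
  have -> : lo = nu 0 by rewrite /lo /hi; lia.
  by rewrite !subnn !expr0; ring.
Qed.

End LowerRows.

Lemma open_rows X r (f g nu mu : nat -> nat) k :
  (forall i, (i < r)%N -> (k.+2 <= f i)%N) ->
  (\prod_(i < r) step_weight X (f i) k.+1 (g i) (mu i) (mu i.+1)) *
  (\prod_(i < r) step_weight X (f i) k (nu i) (g i) (g i.+1)) =
  \prod_(i < r) (strip_weight (X k) (nu i) (g i) * corner_weight (X k) (nu i) (g i.+1) *
    (strip_weight (X k.+1) (g i) (mu i) * corner_weight (X k.+1) (g i) (mu i.+1))).
Proof.
move=> le_f; rewrite -big_split; apply: eq_bigr => i _ /=.
have lt_k : (k.+1 < f i)%N by exact: le_f.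
by rewrite !step_weight_open //; [ring | exact: ltnW].
Qed.

Definition two_steps X r (f : nat -> nat) k (nu mu : nat -> nat) : A :=
  shape_sum r (fun rho =>
    (\prod_(i < r) step_weight X (f i) k.+1 (rho i) (mu i) (mu i.+1)) *
    (\prod_(i < r) step_weight X (f i) k (nu i) (rho i) (rho i.+1))).

(** With flag [k + 1] the first row is closed to the letter [k + 1], so its length must be [L + 1]
    already after the letter [k]: a single term of the sum survives. *)
Lemma two_steps_top X r f k nu mu L : (mu 0 <= L)%N -> (L.+1 < N)%N ->
  (forall i, (i < r)%N -> (k.+2 <= f i)%N) ->
  two_steps X r.+1 (fcons k.+1 f) k nu (fcons L.+1 mu) =
  strip_weight (X k) (nu 0) L.+1 *
    lower_rows (X k) (X k.+1) r (nu 0) (nu \o S) mu.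
Proof.
move=> le_mu lt_L le_f; rewrite /two_steps shape_sumS.
rewrite (bigD1 (Ordinal lt_L)) //= [X in _ + X]big1 ?addr0 => [|n ne_n].
  rewrite /lower_rows /shape_sum mulr_sumr; apply: eq_bigr => v _.
  rewrite -(open_rows _ _ _ _ le_f) !big_ord_recl /= step_weight_closed // step_weight_open //=.
  rewrite eqxx (leq_trans le_mu) //=.
  by set P := \prod_(i < r) _; set Q := \prod_(i < r) _; ring.
apply: big1 => v _; rewrite big_ord_recl /= step_weight_closed //.
by rewrite -val_eqE in ne_n; rewrite (negPf ne_n) !mul0r.
Qed.

Lemma two_steps_next X r f k nu mu L :
  (forall i, (i < r)%N -> (k.+2 <= f i)%N) ->
  two_steps X r.+1 (fcons k.+2 f) k nu (fcons L mu) =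
  (\sum_(n < N) strip_weight (X k) (nu 0) n * strip_weight (X k.+1) n L *
                corner_weight (X k.+1) n (mu 0)) *
    lower_rows (X k) (X k.+1) r (nu 0) (nu \o S) mu.
Proof.
move=> le_f; rewrite /two_steps shape_sumS mulr_suml; apply: eq_bigr => n _.
rewrite /lower_rows /shape_sum mulr_sumr; apply: eq_bigr => v _.
rewrite -(open_rows _ _ _ _ le_f) !big_ord_recl /= !step_weight_open //=.
by set P := \prod_(i < r) _; set Q := \prod_(i < r) _; ring.
Qed.

Lemma chain_sum_flag_eq X r f g m mu :
  (forall i j, (i < r)%N -> (j < m)%N -> (j < f i)%N = (j < g i)%N) ->
  chain_sum X r f m mu = chain_sum X r g m mu.
Proof.
elim: m mu => //= m IHm mu eq_fg; apply: eq_bigr => v _.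
rewrite IHm => [|i j lt_i lt_j]; last by apply: eq_fg => //; exact: ltnW.
by congr (_ * _); apply: eq_bigr => i _; rewrite /step_weight eq_fg.
Qed.

(** * Raising the first flag by one *)

Section KeyStep.

Variables (s : {rmorphism A -> A}) (X : nat -> A) (k : nat).
Hypotheses (sb : s b = b) (sx : s (X k) = X k.+1) (sy : s (X k.+1) = X k).
Hypothesis (sX : forall j, j != k -> j != k.+1 -> s (X j) = X j).

Lemma s_step_weight F m n p q : m != k -> m != k.+1 ->
  s (step_weight X F m n p q) = step_weight X F m n p q.
Proof.
move=> mk mk1; rewrite /step_weight; case: ifP => _; last exact: rmorph0.
rewrite rmorphM rmorphXn /= (sX mk mk1); congr (_ * _).
by case: ifP => _; rewrite ?rmorphD ?rmorphM rmorph1 ?sb ?(sX mk mk1).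
Qed.

Lemma s_chain_sum r f m mu : (m <= k)%N -> s (chain_sum X r f m mu) = chain_sum X r f m mu.
Proof.
elim: m mu => [|m IHm] mu lt_m /=.
  by rewrite rmorph_prod; apply: eq_bigr => i _; case: eqP; rewrite ?rmorph0 ?rmorph1.
rewrite rmorph_sum; apply: eq_bigr => v _; rewrite rmorphM IHm ?(ltnW lt_m) //.
congr (_ * _); rewrite rmorph_prod; apply: eq_bigr => i _.
by rewrite s_step_weight //; lia.
Qed.

Local Notation isPiX := (isPi s (X k) (X k.+1)).

(** After removal of the symmetric factor of the lower rows, the operator must carry
    [X k ^+ (L + 1 - a)] times an edge factor to a one-row sum. The cases are [a <= p], [p < a <= L]
    and [a = L + 1]; for larger [a] both sides vanish. *)
Lemma isPi_two_steps r f nu mu L : (mu 0 <= L)%N -> (L.+1 < N)%N ->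
  (forall i, (i < r)%N -> (k.+2 <= f i)%N) ->
  mu r = 0%N -> (forall i, (mu i < N)%N) ->
  isPiX (two_steps X r.+1 (fcons k.+1 f) k nu (fcons L.+1 mu))
       (two_steps X r.+1 (fcons k.+2 f) k nu (fcons L mu)).
Proof.
move=> le_mu lt_L le_f mu_r lt_mu.
rewrite two_steps_top // two_steps_next // top_row_sum; last exact: ltnW.
have [S sS ->] := lower_rows_edge sb sx sy (nu 0) (nu \o succn) mu_r lt_mu.
rewrite !mulrA ![_ * S]mulrC; apply: isPiM => //.
set a := nu 0; set p := mu 0 in le_mu *.
rewrite /strip_weight /edge; have [le_ap|lt_pa] := leqP a p.
  have -> : (a <= L.+1)%N by lia.
  rewrite le_mu (_ : (L.+1 - a = (p - a) + (L - p).+1)%N); last by lia.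
  have sc : s ((X k * X k.+1) ^+ (p - a)) = (X k * X k.+1) ^+ (p - a).
    by rewrite rmorphXn rmorphM /= sx sy mulrC.
  have := isPiM sc (isPi_exp sx (L - p)).
  rewrite exprD exprMn mulr1; congr (isPi _ _ _ _ _); ring.
rewrite subnn expr0 mul1r.
have [le_a|lt_a] := leqP a L.+1; last first.
  by rewrite leqNgt (ltnW lt_a) /= !mul0r; exact: isPi0.
have [le_aL|lt_aL] := leqP a L.
  rewrite subSn // mulrC; have := isPi_exp1 sb sx (L - a).
  by congr (isPi _ _ _ _ _); ring.
(* Here [a = L + 1]: the row is too long to end with [L] boxes, so the right side is zero, and the
   operator kills [1 + b * X k]. *)
have -> : (L.+1 - a = 0)%N by lia.
by rewrite expr0 mul1r mul0r; exact: isPi_1x.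
Qed.

Lemma chain_sum_two_steps r f mu :
  chain_sum X r f k.+2 mu = shape_sum r (fun nu => two_steps X r f k nu mu * chain_sum X r f k nu).
Proof.
rewrite /= /shape_sum /two_steps /shape_sum.
under eq_bigr do rewrite mulr_sumr.
rewrite exchange_big; apply: eq_bigr => v _ /=; rewrite mulr_suml.
by apply: eq_bigr => w _; rewrite mulrA.
Qed.

(** Induction on the letters above [k + 1]. They are closed to the first row, whose length is
    therefore frozen, and their weights in the other rows do not involve the two exchanged
    variables. *)
Lemma isPi_chain_sum r f m mu L : (k.+2 <= m)%N -> (mu 0 <= L)%N -> (L.+1 < N)%N ->
  (forall i, (i < r)%N -> (k.+2 <= f i)%N) ->
  mu r = 0%N -> (forall i, (mu i < N)%N) ->
  isPiX (chain_sum X r.+1 (fcons k.+1 f) m (fcons L.+1 mu))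
       (chain_sum X r.+1 (fcons k.+2 f) m (fcons L mu)).
Proof.
move=> le_m; rewrite -(subnKC le_m) addnC; move: (m - k.+2)%N => {le_m}m.
move=> le_mu lt_L le_f mu_r lt_mu; elim: m mu le_mu mu_r lt_mu => [|m IHm] mu le_mu mu_r lt_mu.
  rewrite add0n !chain_sum_two_steps; apply: isPi_sum => v.
  rewrite (@chain_sum_flag_eq X r.+1 (fcons k.+2 f) (fcons k.+1 f)); last first.
    by case=> //= j _ lt_j; lia.
  rewrite ![_ * chain_sum _ _ _ _ _]mulrC; apply: isPiM; first exact: s_chain_sum.
  exact: isPi_two_steps.
have lt_L' : (L < N)%N := ltnW lt_L.
rewrite addSn /= !shape_sumS (bigD1 (Ordinal lt_L)) //=.
rewrite [X in _ + X]big1 ?addr0 => [|n ne_n]; last first.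
  apply: big1 => v _; rewrite big_ord_recl /= step_weight_closed; last by lia.
  by rewrite -val_eqE in ne_n; rewrite (negPf ne_n) !mul0r.
rewrite [X in isPiX _ X](bigD1 (Ordinal lt_L')) //=.
rewrite [X in isPiX _ (_ + X)]big1 ?addr0 => [|n ne_n]; last first.
  apply: big1 => v _; rewrite big_ord_recl /= step_weight_closed; last by lia.
  by rewrite -val_eqE in ne_n; rewrite (negPf ne_n) !mul0r.
apply: isPi_sum => v; rewrite !big_ord_recl /= !step_weight_closed; try by lia.
rewrite !eqxx le_mu (leq_trans le_mu) //= !mul1r.
(* The induction hypothesis needs the smaller shape to fit under [L]; otherwise its first part
   exceeds [mu 0] and its weight is zero. *)
have [le_v|lt_v] := leqP (shape_of v 0) L; last first.
  case: r le_f v lt_v mu_r {IHm} => [|r] le_f v lt_v mu_r; first by rewrite shape_of0 in lt_v.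
  rewrite big_ord_recl /= /step_weight [(shape_of v 0 <= mu 0)%N]leqNgt (leq_ltn_trans le_mu) //=.
  by rewrite andbF !mul0r; exact: isPi0.
apply: isPiM; last first.
  apply: IHm => // [|i]; first by rewrite /shape_of fun_ext_out.
  have [lt_i|le_i] := ltnP i r; first by rewrite /shape_of (fun_ext_lt _ _ lt_i).
  by rewrite /shape_of fun_ext_out //; lia.
rewrite rmorph_prod; apply: eq_bigr => i _; rewrite s_step_weight //; lia.
Qed.

End KeyStep.

(** * Splitting off a first row with flag 1 *)

Lemma step_weight_shift X F m n p q : (0 < F)%N ->
  step_weight X F m.+1 n p q = step_weight (X \o S) F.-1 m n p q.
Proof. by case: F. Qed.

Lemma prod_empty_rows X r mu : mu r = 0%N ->
  (mu 0 == 0%N)%:R *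
    \prod_(i < r) (if mu i.+1 == 0%N then X ^+ mu i else 0 : A) =
  \prod_(i < r) (mu i == 0%N)%:R.
Proof.
elim: r mu => [|r IHr] mu mu_r; first by rewrite mu_r eqxx !big_ord0 mul1r.
rewrite !big_ord_recl /=; have [->|ne] := eqVneq (mu 0) 0%N; last by rewrite !mul0r.
rewrite !mul1r expr0 -(IHr (mu \o S)) //=.
by case: eqP => _.
Qed.

Lemma chain_sum1 X r f mu : (0 < N)%N -> mu r = 0%N -> (forall i, (i < r)%N -> (0 < f i)%N) ->
  chain_sum X r f 1 mu = \prod_(i < r) (if mu i.+1 == 0%N then X 0 ^+ mu i else 0).
Proof.
move=> lt_N mu_r f_gt0; pose v0 : {ffun 'I_r -> 'I_N} := [ffun=> Ordinal lt_N].
rewrite /= /shape_sum (bigD1 v0) //=.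
have shape_ofE i : shape_of v0 i = 0%N.
  have [lt_i|le_i] := ltnP i r; last exact: fun_ext_out.
  by rewrite /shape_of (fun_ext_lt _ _ lt_i) ffunE.
rewrite [X in _ + X]big1 ?addr0 => [|v ne_v].
  rewrite [X in _ * X]big1 ?mulr1 => [|i _]; last by rewrite shape_ofE eqxx.
  apply: eq_bigr => i _; rewrite shape_ofE /step_weight leqn0 f_gt0 //= subn0.
  by case: eqP => //= _; rewrite mulr1.
have /existsP [i vi] : [exists i, v i != Ordinal lt_N].
  rewrite -negb_forall; apply: contra ne_v => /forallP vE.
  by apply/eqP/ffunP => i; rewrite ffunE; exact/eqP.
rewrite [X in _ * X](bigD1 i) //= /shape_of fun_ext_in -val_eqE in vi *.
by rewrite (negPf vi) mul0r mulr0.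
Qed.

Local Arguments chain_sum : simpl never.

(** With flag 1 the first row is filled by the letter 0 alone, and column strictness keeps this
    letter out of the rows below. These use the letters from 1 on, whence the shifted variables and
    the lowered flags. *)
Lemma chain_sum_first_row X r f m L mu : (L < N)%N -> mu r = 0%N -> (mu 0 <= L)%N ->
  (forall i, (i < r)%N -> (0 < f i)%N) ->
  chain_sum X r.+1 (fcons 1%N f) m.+1 (fcons L mu) =
  X 0 ^+ L * chain_sum (X \o S) r (predn \o f) m mu.
Proof.
move=> lt_L mu_r le_mu f_gt0; elim: m mu mu_r le_mu => [|m IHm] mu mu_r le_mu.
  rewrite chain_sum1 //; try by case.
    rewrite -[chain_sum (X \o S) _ _ 0 _]/(\prod_(i < r) (mu i == 0%N)%:R).
    rewrite big_ord_recl /= -(prod_empty_rows (X 0) mu_r).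
    by case: eqP => _ /=; ring.
  exact: leq_ltn_trans lt_L.
change (shape_sum r.+1 (fun nu => (\prod_(i < r.+1) step_weight X (fcons 1%N f i) m.+1
    (nu i) (fcons L mu i) (fcons L mu i.+1)) * chain_sum X r.+1 (fcons 1%N f) m.+1 nu) =
  X 0 ^+ L * shape_sum r (fun nu => (\prod_(i < r) step_weight (X \o S) (f i).-1 m
    (nu i) (mu i) (mu i.+1)) * chain_sum (X \o S) r (predn \o f) m nu)).
rewrite shape_sumS (bigD1 (Ordinal lt_L)) //=.
rewrite [X in _ + X]big1 ?addr0 => [|n ne_n]; last first.
  apply: big1 => v _; rewrite big_ord_recl /= step_weight_closed //.
  by rewrite -val_eqE in ne_n; rewrite (negPf ne_n) !mul0r.
rewrite /shape_sum mulr_sumr; apply: eq_bigr => v _.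
rewrite big_ord_recl /= step_weight_closed //= eqxx le_mu /= mul1r.
have -> : \prod_(i < r) step_weight X (f i) m.+1 (shape_of v i) (mu i) (mu i.+1) =
    \prod_(i < r) step_weight (X \o S) (f i).-1 m (shape_of v i) (mu i) (mu i.+1).
  by apply: eq_bigr => i _; rewrite step_weight_shift // f_gt0.
have [le_v|lt_v] := leqP (shape_of v 0) L.
  by rewrite IHm ?mulrA ?[_ * X 0 ^+ L]mulrC // /shape_of fun_ext_out.
case: r f_gt0 v lt_v mu_r {IHm} => [|r] f_gt0 v lt_v mu_r; first by rewrite shape_of0 in lt_v.
rewrite big_ord_recl /= /(step_weight _ _ _ (shape_of v 0)) [(shape_of v 0 <= mu 0)%N]leqNgt.
by rewrite (leq_ltn_trans le_mu) //= andbF !mul0r mulr0.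
Qed.

End Transfer.

(** * Braid relations and reduced words *)

Lemma s_invol i : involutive (s i).
Proof. by move=> k; rewrite /s; do !case: eqP; lia. Qed.

Lemma swapB i u v : swap i (u - v) = swap i u - swap i v.
Proof. exact: rmorphB. Qed.

Lemma swapM i u v : swap i (u * v) = swap i u * swap i v.
Proof. exact: rmorphM. Qed.

Lemma swap_beta i : swap i beta = beta.
Proof. by rewrite beta.unlock swapC. Qed.

Lemma swap_ext (g h : {rmorphism polyring -> polyring}) :
  (forall c, g c%:MP = h c%:MP) -> (forall k, g (x k) = h (x k)) -> g =1 h.
Proof.
move=> Ec Ex; elim/malg_ind => // u v Eu Ev; first by rewrite !rmorphD Eu Ev.
by rewrite !rmorphM Eu Ev.
Qed.

Lemma swapK i : involutive (swap i).
Proof.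
apply: (@swap_ext (swap i \o swap i)%FUN idfun) => [c|k] /=; first by rewrite !swapC.
by rewrite !swapX s_invol.
Qed.

Lemma swap_comm i j : (i.+1 < j)%N -> swap i \o swap j =1 swap j \o swap i.
Proof.
move=> lt_ij; apply: (@swap_ext (swap i \o swap j)%FUN (swap j \o swap i)%FUN) => [c|k] /=.
  by rewrite !swapC.
by rewrite !swapX; congr x; rewrite /s; do !case: eqP; lia.
Qed.

Lemma swap_braid i :
  swap i \o swap i.+1 \o swap i =1 swap i.+1 \o swap i \o swap i.+1.
Proof.
apply: (@swap_ext (swap i \o swap i.+1 \o swap i)%FUN
  (swap i.+1 \o swap i \o swap i.+1)%FUN) => [c|k] /=.
  by rewrite !swapC.
by rewrite !swapX; congr x; rewrite /s; do !case: eqP; lia.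
Qed.

Section BraidAlgebra.

Variables (A : comNzRingType) (b : A).

(** [p], [q] and [r] stand for [pi i h], [pi j (pi i h)] and [pi j h]; [p'] and [r'] are the images
    of [p] and [r] under the other exchange. The result is the relation that characterises
    [pi i (pi j h)], up to the factor [z - w]. *)
Lemma pi_commute_algebra (x y z w h h1 h2 h12 h21 p q p' r r' : A) :
  h12 = h21 ->
  (x - y) * p = (1 + b * y) * h - (1 + b * x) * h1 ->
  (x - y) * p' = (1 + b * y) * h2 - (1 + b * x) * h12 ->
  (z - w) * q = (1 + b * w) * p - (1 + b * z) * p' ->
  (z - w) * r = (1 + b * w) * h - (1 + b * z) * h2 ->
  (z - w) * r' = (1 + b * w) * h1 - (1 + b * z) * h21 ->
  (z - w) * ((x - y) * q) =
  (z - w) * ((1 + b * y) * r - (1 + b * x) * r').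
Proof.
move=> <- E1 E2 E3 E4 E5.
rewrite mulrCA E3 mulrBr [(x - y) * _]mulrCA E1 [(x - y) * _]mulrCA E2.
rewrite [RHS]mulrBr [(z - w) * _]mulrCA E4 [(z - w) * _]mulrCA E5; ring.
Qed.

(* The common value of (x - y)(x - z)(y - z) pi_i pi_(i+1) pi_i h and of
   (x - y)(x - z)(y - z) pi_(i+1) pi_i pi_(i+1) h; hts is
   swap (i+1) (swap i h), and so on, with s for swap i and t for swap (i+1). *)
Definition braid_value (x y z h hs ht hts hst hsts : A) : A :=
  let X := 1 + b * x in let Y := 1 + b * y in let Z := 1 + b * z in
  Y * Z * Z * h - X * Z * Z * hs - Y * Y * Z * ht + X * Y * Y * hts
  + X * X * Z * hst - X * X * Y * hsts.

(** Here [g = pi i h], [k = pi i.+1 g] and [m = pi i k], with suffixes for exchanges as in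
    [braid_value]. Successive substitution divides by [x - y] twice, hence the extra factor [x - y]
    on both sides. *)
Lemma pi_braid_left (x y z h hs ht hts hst hsts g gt gs gst k ks m : A) :
  (x - y) * g = (1 + b * y) * h - (1 + b * x) * hs ->
  (x - z) * gt = (1 + b * z) * ht - (1 + b * x) * hts ->
  (y - x) * gs = (1 + b * x) * hs - (1 + b * y) * h ->
  (y - z) * gst = (1 + b * z) * hst - (1 + b * y) * hsts ->
  (y - z) * k = (1 + b * z) * g - (1 + b * y) * gt ->
  (x - z) * ks = (1 + b * z) * gs - (1 + b * x) * gst ->
  (x - y) * m = (1 + b * y) * k - (1 + b * x) * ks ->
  (x - y) * ((x - y) * ((x - z) * ((y - z) * m))) =
  (x - y) * braid_value x y z h hs ht hts hst hsts.
Proof.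
have sub0 u v : u = v -> u - v = 0 :> A by move=> ->; rewrite subrr.
rewrite /braid_value.
move=> /sub0 Eg /sub0 Egt /sub0 Egs /sub0 Egst /sub0 Ek /sub0 Eks /sub0 Em.
apply/eqP; rewrite -subr_eq0; apply/eqP.
pose D := (x - y) * ((x - z) * (y - z)).
(* Each 0 is to be replaced by the difference of the two sides of one hypothesis; the coefficients
   are those of successive substitution. *)
transitivity (D * 0 + (x - y) * (x - z) * (1 + b * y) * 0
  - (1 + b * x) * (x - y) * (y - z) * 0 + (x - z) * (1 + b * y) * (1 + b * z) * 0
  - (x - y) * (1 + b * y) * (1 + b * y) * 0 + (1 + b * x) * (1 + b * z) * (y - z) * 0
  + (1 + b * x) * (1 + b * x) * (x - y) * 0); last by ring.
rewrite -{1}Em -{1}Ek -{1}Eks -{1}Eg -{1}Egt -{1}Egs -{1}Egst /D; ring.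
Qed.

Lemma pi_braid_right (x y z h hs ht hts hst hsts g gt gs gts k kt m : A) :
  (y - z) * g = (1 + b * z) * h - (1 + b * y) * ht ->
  (x - z) * gs = (1 + b * z) * hs - (1 + b * x) * hst ->
  (z - y) * gt = (1 + b * y) * ht - (1 + b * z) * h ->
  (x - y) * gts = (1 + b * y) * hts - (1 + b * x) * hsts ->
  (x - y) * k = (1 + b * y) * g - (1 + b * x) * gs ->
  (x - z) * kt = (1 + b * z) * gt - (1 + b * x) * gts ->
  (y - z) * m = (1 + b * z) * k - (1 + b * y) * kt ->
  (y - z) * ((x - y) * ((x - z) * ((y - z) * m))) =
  (y - z) * braid_value x y z h hs ht hts hst hsts.
Proof.
have sub0 u v : u = v -> u - v = 0 :> A by move=> ->; rewrite subrr.
rewrite /braid_value.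
move=> /sub0 Eg /sub0 Egs /sub0 Egt /sub0 Egts /sub0 Ek /sub0 Ekt /sub0 Em.
apply/eqP; rewrite -subr_eq0; apply/eqP.
pose D := (x - y) * ((x - z) * (y - z)).
transitivity (D * 0 + (y - z) * (x - z) * (1 + b * z) * 0
  - (1 + b * y) * (x - y) * (y - z) * 0 + (x - z) * (1 + b * y) * (1 + b * z) * 0
  - (1 + b * z) * (1 + b * x) * (y - z) * 0 + (1 + b * y) * (1 + b * z) * (x - y) * 0
  + (1 + b * x) * (1 + b * y) * (y - z) * 0); last by ring.
rewrite -{1}Em -{1}Ek -{1}Ekt -{1}Eg -{1}Egs -{1}Egt -{1}Egts /D; ring.
Qed.

End BraidAlgebra.

Lemma rmorph_is_pi (A : comNzRingType) (t : {rmorphism A -> A})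
    (b u v u' v' h h' g : A) :
  t b = b -> t u = u' -> t v = v' ->
  (u - v) * g = (1 + b * v) * h - (1 + b * u) * h' ->
  (u' - v') * t g = (1 + b * v') * t h - (1 + b * u') * t h'.
Proof.
move=> Eb Eu Ev /(congr1 t).
by rewrite rmorphM !rmorphB !rmorphM !rmorphD !rmorphM rmorph1 Eb Eu Ev.
Qed.

Lemma swap_is_pi j i h g : is_pi i h g ->
  (x (s j i) - x (s j i.+1)) * swap j g =
  (1 + beta * x (s j i.+1)) * swap j h - (1 + beta * x (s j i)) * swap j (swap i h).
Proof. exact: rmorph_is_pi (swap_beta j) (swapX j i) (swapX j i.+1). Qed.

Lemma swap2_is_pi l j i h g : is_pi i h g ->
  (x (s l (s j i)) - x (s l (s j i.+1))) * swap l (swap j g) =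
  (1 + beta * x (s l (s j i.+1))) * swap l (swap j h)
  - (1 + beta * x (s l (s j i))) * swap l (swap j (swap i h)).
Proof.
move/(swap_is_pi j).
exact: rmorph_is_pi (swap_beta l) (swapX l (s j i)) (swapX l (s j i.+1)).
Qed.

Lemma subX_cancel i (g h : polyring) :
  (x i - x i.+1) * g = (x i - x i.+1) * h -> g = h.
Proof.
move/eqP; rewrite -subr_eq0 -mulrBr => /eqP/subX_reg/eqP.
by rewrite subr_eq0 => /eqP.
Qed.

Lemma s_id i k : k != i -> k != i.+1 -> s i k = k.
Proof. by rewrite /s => /negPf -> /negPf ->. Qed.

Lemma s_l i : s i i = i.+1. Proof. by rewrite /s eqxx. Qed.

Lemma s_r i : s i i.+1 = i.
Proof. by rewrite /s eqxx gtn_eqF. Qed.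

(** [swap i.+1] turns [x i - x i.+2] into [x i - x i.+1], which is already known to be regular. *)
Lemma subX2_cancel i (g h : polyring) :
  (x i - x i.+2) * g = (x i - x i.+2) * h -> g = h.
Proof.
have E k : swap i.+1 ((x i - x i.+2) * k) = (x i - x i.+1) * swap i.+1 k.
  by rewrite swapM swapB !swapX s_r s_id // ltn_eqF.
move=> Egh; apply: (can_inj (swapK i.+1)); apply: (@subX_cancel i).
exact: etrans (esym (E g)) (etrans (congr1 (swap i.+1) Egh) (E h)).
Qed.

Lemma pi_comm i j h : (i.+1 < j)%N -> pi i (pi j h) = pi j (pi i h).
Proof.
move=> lt_ij; apply/esym/pi_uniq; apply: (@subX_cancel j).
have sj : s j i = i by apply: s_id; lia.
have sj1 : s j i.+1 = i.+1 by apply: s_id; lia.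
have si : s i j = j by apply: s_id; lia.
have si1 : s i j.+1 = j.+1 by apply: s_id; lia.
have E2 := swap_is_pi j (pi_spec i h); rewrite sj sj1 in E2.
have E5 := swap_is_pi i (pi_spec j h).
rewrite si si1 in E5.
exact: (pi_commute_algebra (esym (swap_comm lt_ij h)) (pi_spec i h) E2
  (pi_spec j _) (pi_spec j h) E5).
Qed.

Lemma pi_braid i h :
  pi i (pi i.+1 (pi i h)) = pi i.+1 (pi i (pi i.+1 h)).
Proof.
have s0 : s i i.+2 = i.+2 by apply: s_id; lia.
have s1 : s i.+1 i = i by apply: s_id; lia.
have EL : (x i - x i.+1) * ((x i - x i.+2) * ((x i.+1 - x i.+2) *
    pi i (pi i.+1 (pi i h)))) =
  braid_value beta (x i) (x i.+1) (x i.+2) h (swap i h) (swap i.+1 h)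
    (swap i.+1 (swap i h)) (swap i (swap i.+1 h))
    (swap i (swap i.+1 (swap i h))).
  apply: (@subX_cancel i).
  have E1 := pi_spec i h.
  have E2 := swap_is_pi i.+1 E1; rewrite s_l s1 in E2.
  have E3 := swap_is_pi i E1; rewrite s_l s_r swapK in E3.
  have E4 := swap2_is_pi i i.+1 E1; rewrite s_l s1 s_l s0 in E4.
  have E6 := swap_is_pi i (pi_spec i.+1 (pi i h)); rewrite s_r s0 in E6.
  exact: (pi_braid_left E1 E2 E3 E4 (pi_spec _ _) E6 (pi_spec _ _)).
have ER : (x i - x i.+1) * ((x i - x i.+2) * ((x i.+1 - x i.+2) *
    pi i.+1 (pi i (pi i.+1 h)))) =
  braid_value beta (x i) (x i.+1) (x i.+2) h (swap i h) (swap i.+1 h)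
    (swap i.+1 (swap i h)) (swap i (swap i.+1 h))
    (swap i.+1 (swap i (swap i.+1 h))).
  apply: (@subX_cancel i.+1).
  have E1 := pi_spec i.+1 h.
  have E2 := swap_is_pi i E1; rewrite s_r s0 in E2.
  have E3 := swap_is_pi i.+1 E1; rewrite s_l s_r swapK in E3.
  have E4 := swap2_is_pi i.+1 i E1; rewrite s_r s1 s0 s_r in E4.
  have E6 := swap_is_pi i.+1 (pi_spec i (pi i.+1 h)); rewrite s_l s1 in E6.
  exact: (pi_braid_right E1 E2 E3 E4 (pi_spec _ _) E6 (pi_spec _ _)).
apply: (@subX_cancel i.+1); apply: subX2_cancel; apply: (@subX_cancel i).
(* The two common values differ only in their last argument, where the braid relation of the
   exchanges applies. *)
exact: etrans EL (etrans (congr1 (braid_value _ _ _ _ _ _ _ _ _) (swap_braid i h))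
  (esym ER)).
Qed.

(** * Words, braid moves and runs *)

Lemma pi_word_cat u v h : pi_word (u ++ v) h = pi_word v (pi_word u h).
Proof. exact: foldl_cat. Qed.

Lemma word_perm_cat u v k : word_perm (u ++ v) k = word_perm u (word_perm v k).
Proof. by elim: u => //= i u ->. Qed.

Lemma word_perm_rev u : cancel (word_perm (rev u)) (word_perm u).
Proof.
elim: u => // i u IHu k; rewrite rev_cons -cats1 word_perm_cat /= IHu.
exact: s_invol.
Qed.

Lemma word_permK u : cancel (word_perm u) (word_perm (rev u)).
Proof. by move=> k; rewrite -{2}[u]revK word_perm_rev. Qed.

Lemma word_perm_id u k : all (ltn k) u -> word_perm u k = k.
Proof.
elim: u => //= i u IHu /andP [lt_ki /IHu ->].
by apply: s_id; rewrite ltn_eqF // ltnW.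
Qed.

(** Not the relation generated by braid moves, but the three invariants of it that are used. *)
Definition braid_eq (u v : seq nat) : Prop :=
  [/\ size u = size v, word_perm u =1 word_perm v & pi_word u =1 pi_word v].

Lemma braid_eq_refl u : braid_eq u u. Proof. by []. Qed.

Lemma braid_eq_sym u v : braid_eq u v -> braid_eq v u.
Proof. by move=> [E1 E2 E3]; split=> // k; rewrite ?E2 ?E3. Qed.

Lemma braid_eq_trans v u w : braid_eq u v -> braid_eq v w -> braid_eq u w.
Proof.
move=> [E1 E2 E3] [F1 F2 F3]; split=> [|k|h]; first by rewrite E1.
  by rewrite E2.
by rewrite E3.
Qed.

Lemma braid_eq_cat u u' v v' : braid_eq u u' -> braid_eq v v' -> braid_eq (u ++ v) (u' ++ v').
Proof.
move=> [E1 E2 E3] [F1 F2 F3]; split=> [|k|h]; first by rewrite !size_cat E1 F1.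
  by rewrite !word_perm_cat F2 E2.
by rewrite !pi_word_cat E3 F3.
Qed.

Lemma braid_eq_cons i u v : braid_eq u v -> braid_eq (i :: u) (i :: v).
Proof. exact: (braid_eq_cat (braid_eq_refl [:: i])). Qed.

Lemma braid_eq_comm i j : (i.+1 < j)%N || (j.+1 < i)%N -> braid_eq [:: i; j] [:: j; i].
Proof.
wlog lt_ij : i j / (i.+1 < j)%N => [IH|_].
  case/orP => lt; first by apply: IH; rewrite ?lt.
  by apply: braid_eq_sym; apply: IH; rewrite ?lt.
split; [by [] | move=> k /= | move=> h; exact: esym (pi_comm h lt_ij)].
by rewrite /s; do !case: eqP; lia.
Qed.

Lemma braid_eq_braid i : braid_eq [:: i; i.+1; i] [:: i.+1; i; i.+1].
Proof.
split; [by [] | move=> k /= | move=> h; exact: pi_braid i h].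
by rewrite /s; do !case: eqP; lia.
Qed.

Lemma braid_eq_rcons_cons u j :
  all (fun i => (i.+1 < j)%N || (j.+1 < i)%N) u -> braid_eq (u ++ [:: j]) (j :: u).
Proof.
elim: u => //= i u IHu /andP [ij /IHu E].
apply: (braid_eq_trans (braid_eq_cons i E)).
exact: (braid_eq_cat (braid_eq_comm ij) (braid_eq_refl u)).
Qed.

(** [j] commutes leftwards past the letters above [j + 1], a braid move on [j, j + 1, j] turns it
    into [j + 1], and this commutes past the letters below [j]. *)
Lemma braid_eq_run d c j : (d <= j)%N -> (j.+1 < d + c)%N ->
  braid_eq (iota d c ++ [:: j]) (j.+1 :: iota d c).
Proof.
elim: c d => [|c IHc] d le_dj lt_j; first lia.
have [lt_dj|] := ltnP d j.
  have lt_j' : (j.+1 < d.+1 + c)%N by lia.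
  apply: (braid_eq_trans (braid_eq_cons d (IHc d.+1 lt_dj lt_j'))).
  by apply: (braid_eq_cat (braid_eq_comm _) (braid_eq_refl (iota d.+1 c))); rewrite ltnS lt_dj.
move=> le_jd; have ? : j = d by lia.
subst j; case: c lt_j {IHc} => [|c] lt_j; first lia.
have E : braid_eq (iota d.+2 c ++ [:: d]) (d :: iota d.+2 c).
  apply: braid_eq_rcons_cons; apply/allP => i; rewrite mem_iota; lia.
apply: (braid_eq_trans (braid_eq_cons d (braid_eq_cons d.+1 E))).
exact: (braid_eq_cat (braid_eq_braid d) (braid_eq_refl _)).
Qed.

(* [cs] is the list of lengths of the runs starting at d, d + 1, ...; the word
   lists the runs in decreasing order of their starting points. *)
Fixpoint run_word (d : nat) (cs : seq nat) : seq nat :=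
  if cs is c :: cs' then run_word d.+1 cs' ++ iota d c else [::].

(* Shorter words need not give the same operator: pi_i is not an involution. *)
Definition reduces (u v : seq nat) : Prop :=
  word_perm u =1 word_perm v /\ ((size v < size u)%N \/ braid_eq u v).

Lemma braid_eq_reduces u v : braid_eq u v -> reduces u v.
Proof. by move=> E; split; [case: E | right]. Qed.

Lemma reduces_trans v u w : reduces u v -> reduces v w -> reduces u w.
Proof.
move=> [E Euv] [F Fvw]; split=> [k|]; first by rewrite E.
case: Euv Fvw => [lt_vu|Euv] [lt_wv|Fvw].
- by left; apply: ltn_trans lt_wv lt_vu.
- by left; case: Fvw => <-.
- by left; case: Euv => ->.
- by right; apply: braid_eq_trans Euv Fvw.
Qed.

Lemma reduces_cat u v w : reduces u v -> reduces (u ++ w) (v ++ w).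
Proof.
move=> [E Euv]; split=> [k|]; first by rewrite !word_perm_cat E.
case: Euv => [lt_vu|Euv]; first by left; rewrite !size_cat ltn_add2r.
by right; apply: braid_eq_cat Euv (braid_eq_refl w).
Qed.

Lemma run_word_letter d n : run_word d (rcons (nseq n 0) 1) = [:: (d + n)%N].
Proof.
by elim: n d => [|n IHn] d /=; rewrite ?addn0 // IHn addSnnS.
Qed.

(** The new letter meets the last run [d, ..., d + c - 1]. It passes unchanged if [j > d + c],
    extends the run if [j = d + c], passes as [j + 1] if [j < d + c - 1], and cancels the last
    letter if [j = d + c - 1]. After passing, it is inserted into the runs further left. *)
Lemma run_word_insert d cs j : (d <= j)%N ->
  exists cs', reduces (run_word d cs ++ [:: j]) (run_word d cs').
Proof.
elim: cs d j => [|c cs IHcs] d j le_dj.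
  exists (rcons (nseq (j - d) 0) 1).
  by rewrite run_word_letter subnKC //; apply/braid_eq_reduces/braid_eq_refl.
have [lt_j|] := ltnP (d + c)%N j.
  have [|cs' Ecs'] := IHcs d.+1 j; first lia.
  exists (c :: cs'); apply: reduces_trans (reduces_cat (iota d c) Ecs').
  rewrite /= -!catA; apply/braid_eq_reduces/(braid_eq_cat (braid_eq_refl _))/braid_eq_rcons_cons.
  by apply/allP => i; rewrite mem_iota; lia.
rewrite leq_eqVlt => /orP [/eqP ->|lt_j].
  exists (c.+1 :: cs); rewrite /= -catA -(iotaD d c 1) addn1.
  exact/braid_eq_reduces/braid_eq_refl.
case: c lt_j => [|c] lt_j; first lia.
have [lt_dcj|le_jdc] := ltnP j (d + c).
  have [|cs' Ecs'] := IHcs d.+1 j.+1; first lia.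
  exists (c.+1 :: cs'); apply: reduces_trans (reduces_cat (iota d c.+1) Ecs').
  rewrite [run_word _ _]/(run_word d.+1 cs ++ iota d c.+1) -!catA.
  apply/braid_eq_reduces/(braid_eq_cat (braid_eq_refl _)).
  by apply: braid_eq_run; rewrite // addnS ltnS.
have -> : j = (d + c)%N by lia.
exists (c :: cs); rewrite [run_word d (c.+1 :: cs)]/(run_word d.+1 cs ++ iota d c.+1).
rewrite -[c.+1]addn1 iotaD /=; split=> [k|].
  by rewrite !word_perm_cat /= s_invol.
by left; rewrite !size_cat /= size_iota; lia.
Qed.

Lemma word_reduces_run_word ws : exists cs, reduces ws (run_word 0 cs).
Proof.
elim/last_ind: ws => [|ws j [cs Ecs]]; first by exists [::]; apply/braid_eq_reduces/braid_eq_refl.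
have [cs' Ecs'] := run_word_insert cs (leq0n j).
by exists cs'; rewrite -cats1; apply: reduces_trans Ecs'; apply: reduces_cat.
Qed.

Lemma run_word_head d cs : run_word d cs = run_word d.+1 (behead cs) ++ iota d (head 0 cs).
Proof. by case: cs. Qed.

Lemma all_run_word d cs : all (leq d) (run_word d cs).
Proof.
elim: cs d => // c cs IHcs d; rewrite /= all_cat; apply/andP; split.
  by apply: sub_all (IHcs d.+1) => k; apply: ltnW.
by apply/allP => k; rewrite mem_iota => /andP [].
Qed.

Lemma word_perm_run d c : word_perm (iota d c) (d + c)%N = d.
Proof.
elim: c d => [|c IHc] d; first by rewrite addn0.
have := IHc d.+1; rewrite addSnnS /= => ->; exact: s_r.
Qed.

Lemma word_perm_run_word_head d cs : word_perm (run_word d cs) (d + head 0 cs)%N = d.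
Proof.
by rewrite run_word_head word_perm_cat word_perm_run; exact: word_perm_id (all_run_word _ _).
Qed.

(** The runs further left fix [d], so the length of the last run is read off from the preimage of
    [d], and that run can be cancelled. The conclusion concerns words because [cs] is determined
    only up to trailing zeros. *)
Lemma run_word_inj d cs cs' :
  word_perm (run_word d cs) =1 word_perm (run_word d cs') -> run_word d cs = run_word d cs'.
Proof.
have [n] : exists n, (size cs <= n)%N && (size cs' <= n)%N.
  by exists (maxn (size cs) (size cs')); rewrite leq_maxl leq_maxr.
elim: n d cs cs' => [|n IHn] d cs cs'.
  by rewrite !leqn0 !size_eq0 => /andP [/eqP -> /eqP ->].
move=> le_n E; have Ec : head 0%N cs = head 0%N cs'.
  apply: (@addnI d); apply: (can_inj (word_permK (run_word d cs'))).
  by rewrite -E !word_perm_run_word_head.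
rewrite !(run_word_head d) Ec; congr (_ ++ _); apply: IHn => [|k].
  by move: le_n; rewrite !size_behead; lia.
have := E (word_perm (rev (iota d (head 0%N cs))) k).
by rewrite !(run_word_head d) -Ec !word_perm_cat word_perm_rev.
Qed.

Lemma pi_perm_run_word cs h : pi_perm (word_perm (run_word 0 cs)) h = pi_word (run_word 0 cs) h.
Proof.
rewrite /pi_perm; set ws := epsilon _ _.
have [Ews min_ws] : reduced_word (word_perm (run_word 0 cs)) ws.
  exact: epsilon_spec (reduced_word_exists _).
have [cs' [E]] := word_reduces_run_word ws.
have <- : run_word 0 cs = run_word 0 cs' by apply: run_word_inj => k; rewrite -E Ews.
case=> [lt_ws|[_ _ ->] //]; have := min_ws (run_word 0 cs) (frefl _).
by rewrite leqNgt lt_ws.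
Qed.

Lemma run_word_map_iota (g : nat -> nat) d n :
  run_word d [seq g i | i <- iota d n] = flatten [seq iota i (g i) | i <- rev (iota d n)].
Proof.
elim: n d => // n IHn d; rewrite /= rev_cons.
by rewrite map_rcons -cats1 flatten_cat IHn /= cats0.
Qed.

Lemma flag_word_run_word f :
  flag_word f = run_word 0 (mkseq (fun i => nth 0 f i - i.+1)%N (size f)).
Proof. by rewrite /mkseq run_word_map_iota. Qed.

(** * Chain sums as values of the operators *)

Lemma fconsE (T : Type) (g : nat -> T) : g = fcons (g 0) (g \o S).
Proof. by apply: functional_extensionality => -[]. Qed.

Lemma isPi_pi i h g : isPi beta (swap i) (x i) (x i.+1) h g -> g = pi i h.
Proof. exact: pi_uniq. Qed.

Lemma pi_word_mulX d a u h :
  all (ltn d) u -> pi_word u (x d ^+ a * h) = x d ^+ a * pi_word u h.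
Proof.
elim: u h => // i u IHu h /andP [lt_di all_u].
rewrite [LHS]/(pi_word u (pi i (x d ^+ a * h))) [pi_word (i :: u) h]/(pi_word u (pi i h)).
rewrite -(IHu (pi i h) all_u); congr (pi_word u _); apply/esym/isPi_pi.
have fix_x : swap i (x d ^+ a) = x d ^+ a.
  have E : swap i (x d) = x d by rewrite swapX s_id // ltn_eqF // ltnW.
  exact: etrans (rmorphXn _ _ _) (congr1 (fun z => z ^+ a) E).
exact: isPiM fix_x (pi_spec i h).
Qed.

Lemma chain_sum_no_rows (A : comNzRingType) (b : A) N X f m mu : chain_sum b N X 0 f m mu = 1.
Proof.
elim: m mu => [|m IHm] mu /=; first by rewrite big_ord0.
by rewrite shape_sum0 big_ord0 mul1r IHm.
Qed.

Definition shifted_x d (j : nat) : polyring := x (j + d).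

Lemma chain_sum_raise_flag N d r f m mu L k : (k.+2 <= m)%N -> (mu 0 <= L)%N -> (L.+1 < N)%N ->
  (forall i, (i < r)%N -> (k.+2 <= f i)%N) ->
  mu r = 0%N -> (forall i, (mu i < N)%N) ->
  chain_sum beta N (shifted_x d) r.+1 (fcons k.+2 f) m (fcons L mu) =
  pi (k + d) (chain_sum beta N (shifted_x d) r.+1 (fcons k.+1 f) m (fcons L.+1 mu)).
Proof.
move=> le_m le_mu lt_L le_f mu_r lt_mu; apply: isPi_pi.
apply: (isPi_chain_sum (X := shifted_x d) (s := swap (k + d)) (k := k)) => //.
- exact: swap_beta.
- exact: etrans (swapX _ _) (congr1 x (s_l (k + d))).
- exact: etrans (swapX _ _) (congr1 x (s_r (k + d))).
- move=> j jk jk1; apply: etrans (swapX _ _) (congr1 x (s_id _ _)); lia.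
Qed.

(** Induction on the rows. The first row starts with length [la 0 + f 0 - 1] and flag 1, where it
    splits off as a power of [x d]; then [pi d, ..., pi (d + f 0 - 2)] raise its flag to [f 0] and
    shorten it to [la 0]. The bound [la i + f i <= N] leaves room for the longer rows. *)
Lemma chain_sum_pi_word N r d f m la : (0 < N)%N ->
  (forall i, (i < r)%N -> (i < f i)%N) ->
  (forall i, (i.+1 < r)%N -> (f i <= f i.+1)%N) ->
  (forall i, (i < r)%N -> (f i <= m)%N) ->
  (forall i, (i < r)%N -> (la i + f i <= N)%N) ->
  (forall i, (la i.+1 <= la i)%N) -> (forall i, (r <= i)%N -> la i = 0%N) ->
  chain_sum beta N (shifted_x d) r f m la =
  pi_word (run_word d (mkseq (fun i => f i - i.+1)%N r))
    (\prod_(i < r) x (i + d) ^+ (la i + f i - i.+1)).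
Proof.
move=> lt0N; elim: r d f m la => [|r IHr] d f m la f_gt f_mono f_le laN la_mono la0.
  by rewrite chain_sum_no_rows big_ord0.
have le_f0 i : (i < r.+1)%N -> (f 0 <= f i)%N.
  elim: i => // i IHi lt_i; exact: leq_trans (IHi (ltnW lt_i)) (f_mono i lt_i).
have lt_la i : (la i < N)%N.
  have [lt_i|le_i] := ltnP i r.+1; last by rewrite la0.
  by have := laN i lt_i; have := f_gt i lt_i; lia.
have f0_gt0 : (0 < f 0)%N by exact: f_gt.
have raise k : (k < f 0)%N ->
    chain_sum beta N (shifted_x d) r.+1 (fcons k.+1 (f \o S)) m
      (fcons (la 0 + f 0 - k.+1)%N (la \o S)) =
    pi_word (iota d k) (chain_sum beta N (shifted_x d) r.+1 (fcons 1%N (f \o S)) m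
      (fcons (la 0 + f 0 - 1)%N (la \o S))).
  elim: k => [|k IHk] lt_k; first by [].
  have -> : iota d k.+1 = iota d k ++ [:: k + d]%N by rewrite -addn1 iotaD addnC.
  rewrite pi_word_cat -(IHk (ltnW lt_k)).
  rewrite chain_sum_raise_flag.
  - by rewrite -subSn ?subSS //; lia.
  - exact: leq_trans (f_le 0%N (ltn0Sn _)).
  - by have := la_mono 0%N; rewrite /=; lia.
  - by have := laN 0%N (ltn0Sn _); lia.
  - by move=> i lt_i; exact: leq_trans (le_f0 i.+1 lt_i).
  - by rewrite /= la0.
  - by move=> i; exact: lt_la.
have [m' Em] : exists m', m = m'.+1.
  by exists m.-1; rewrite prednK //; apply: leq_trans (f_le 0%N _).
have {raise} E0 := raise (f 0).-1; rewrite prednK // leqnn in E0.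
have {E0} := E0 isT; rewrite addnK -!fconsE => ->.
rewrite Em chain_sum_first_row.
- have -> : shifted_x d \o S = shifted_x d.+1.
    by apply: functional_extensionality => j; rewrite /shifted_x /= addnS.
  rewrite IHr.
  (* The operators of the lower rows have indices above [d], so the power of [x d] can be moved
     inside them. *)
  + rewrite -pi_word_mulX; last exact: all_run_word.
    rewrite -pi_word_cat big_ord_recl.
    apply: (f_equal2 pi_word).
      rewrite /mkseq /= subn1; congr (run_word _ _ ++ _).
      rewrite (iotaDl 1 0) -map_comp; apply: eq_map => i /=.
      by rewrite add1n; lia.
    apply: (f_equal2 *%R); first by [].
    apply: eq_bigr => i _; rewrite /= /bump add1n addnS.
    apply: (f_equal2 (@GRing.exp _)); first by [].
    by have := f_gt i.+1 (ltn_ord i); lia.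
  + by move=> i lt_i /=; have := f_gt i.+1 lt_i; lia.
  + by move=> i lt_i /=; have := f_mono i.+1 lt_i; lia.
  + by move=> i lt_i /=; have := f_le i.+1 lt_i; lia.
  + by move=> i lt_i /=; have := laN i.+1 lt_i; have := f_gt i.+1 lt_i; lia.
  + by move=> i; exact: la_mono.
  + by move=> i le_i; exact: la0.
- by have := laN 0%N (ltn0Sn _); lia.
- by rewrite /= la0.
- by have := la_mono 0%N; rewrite /=; lia.
- by move=> i lt_i; have := f_gt i.+1 lt_i; rewrite /=; lia.
Qed.

(** * From set-valued tableaux to chains *)

Lemma prod_if0 (A : comNzRingType) (I : finType) (c : pred I) (F : I -> A) :
  \prod_i (if c i then F i else 0) = if [forall i, c i] then \prod_i F i else 0.
Proof.
case: ifP => [/forallP c_all|/forallPn [i /negPf ci]].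
  by apply: eq_bigr => i _; rewrite c_all.
by rewrite (bigD1 i) //= ci mul0r.
Qed.

Lemma prod_window (A : comNzRingType) n lo hi (z : A) : (hi <= n)%N ->
  \prod_(j < n) (if (lo <= j < hi)%N then z else 1) = z ^+ (hi - lo).
Proof.
move=> le_hi; rewrite -{2}(minn_idPl le_hi); elim: n {le_hi} => [|n IHn].
  by rewrite big_ord0 minn0 sub0n.
rewrite big_ord_recr /= IHn; case: ifP => lo_hi; last first.
  by rewrite mulr1; congr (_ ^+ _); lia.
by rewrite -exprSr; congr (_ ^+ _); lia.
Qed.

(** [P] holds exactly below its least counterexample, which is therefore the cardinality. *)
Lemma ltn_card_initial n (P : pred nat) j :
  (forall i, P i.+1 -> P i) -> (forall i, P i -> (i < n)%N) ->
  (j < #|[set i : 'I_n | P i]|)%N = P j.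
Proof.
move=> P_down P_lt; have exP : exists i, ~~ P i.
  by exists n; apply/negP => /P_lt; rewrite ltnn.
case: (ex_minnP exP) => a Pa min_a.
have Plt i : P i = (i < a)%N.
  apply/idP/idP => [Pi|lt_i]; last by apply/negPn/negP => /min_a; rewrite leqNgt lt_i.
  rewrite ltnNge; apply: contra Pa => le_ai; rewrite -(subnK le_ai) in Pi.
  by elim: (i - a)%N Pi => // d IHd /P_down.
have le_an : (a <= n)%N by apply: min_a; apply/negP => /P_lt; rewrite ltnn.
have -> : #|[set i : 'I_n | P i]| = a.
  rewrite -sum1_card (eq_bigl (fun i : 'I_n => (i < a)%N)) => [|i]; last first.
    by rewrite inE Plt.
  by rewrite -(big_ord_widen n (fun=> 1%N) le_an) sum1_card card_ord.
by rewrite Plt.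
Qed.

Lemma setmin_le n (S : {set 'I_n}) k : k \in S -> (setmin S <= k)%N.
Proof.
rewrite /setmin; move: (index_enum _) (mem_index_enum k) => r kr kS.
elim: r kr => // l r IHr; rewrite inE big_cons => /orP [/eqP <-|/IHr le_k].
  by rewrite kS geq_minl.
by case: ifP => _ //; rewrite geq_min le_k orbT.
Qed.

Lemma setmin_in n (S : {set 'I_n}) :
  S != set0 -> exists2 k, k \in S & setmin S = k :> nat.
Proof.
case/set0Pn => k kS; have: setmin S = n \/ exists2 l, l \in S & setmin S = l :> nat.
  rewrite /setmin; elim/big_ind: _ => [|a c IHa IHc|l lS]; first by left.
    by rewrite /minn; case: ifP.
  by right; exists l.
by case=> // E; have := setmin_le kS; rewrite E leqNgt ltn_ord.
Qed.

Lemma setmin_leq n (S : {set 'I_n}) : (setmin S <= n)%N.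
Proof.
rewrite /setmin; elim/big_ind: _ => // [a c le_a _|k _]; last exact: ltnW.
by rewrite geq_min le_a.
Qed.

(** * Sums over sets with a prescribed minimum *)

Section SetSum.

Variables (A : comNzRingType) (b : A) (X : nat -> A) (M : nat).

Definition set_weight (S : {set 'I_M}) : A :=
  b ^+ (#|S| - 1) * \prod_(k in S) X k.

(** Each admissible letter above the minimum is put in or left out independently, so expanding the
    product over [k] gives the sum over the sets [J] of additional letters. *)
Lemma sum_sets_min (P : pred nat) a :
  \sum_(S : {set 'I_M} | [&& S != set0, setmin S == a & [forall k in S, P k]])
    set_weight S =
  if (a < M)%N && P a then
    X a * \prod_(k < M) (if (a < k)%N && P k then 1 + b * X k else 1)
  else 0.
Proof.
case: ifP => [/andP [lt_a Pa]|not_a]; last first.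
  rewrite big_pred0 // => S; apply/negP => /and3P [/setmin_in [k kS ->] /eqP E /forall_inP].
  by move=> /(_ k kS); rewrite E => Pa; rewrite -E ltn_ord E Pa in not_a.
pose a' := Ordinal lt_a; pose C (k : 'I_M) := (a < k)%N && P k.
under [X in _ = _ * X]eq_bigr => k _.
  have -> : (if (a < k)%N && P k then 1 + b * X k else 1) =
      (if C k then b * X k else 0) + 1.
    by rewrite /C; case: ifP => _; rewrite ?add0r // addrC.
  over.
rewrite bigA_distr mulr_sumr.
rewrite (reindex_onto (fun J => a' |: J) (fun S => S :\ a')) /=; last first.
  move=> S /and3P [/setmin_in [k kS ->] /eqP ka _]; apply: setD1K.
  by rewrite (_ : a' = k) //; apply: val_inj.
rewrite big_mkcond; apply: eq_bigr => J _.
have -> : [&& a' |: J != set0, setmin (a' |: J) == a &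
    [forall k in a' |: J, P k]] && ((a' |: J) :\ a' == J) = [forall k in J, C k].
  rewrite -!andbA; apply/and4P/forall_inP => [[_ /eqP min_a /forall_inP PJ /eqP aJ] k kJ|CJ].
    have kJ' : k \in a' |: J by rewrite inE kJ orbT.
    rewrite /C PJ // andbT ltn_neqAle -{2}min_a setmin_le // andbT.
    by apply: contraTneq kJ => ka; rewrite -aJ !inE -val_eqE /= -ka eqxx.
  have naJ : a' \notin J by apply/negP => /CJ; rewrite /C ltnn.
  split; last by rewrite setU1K.
  - by apply/set0Pn; exists a'; rewrite setU11.
  - have [|k] := @setmin_in _ (a' |: J); first by apply/set0Pn; exists a'; rewrite setU11.
    move=> kJ Ek; rewrite eqn_leq (setmin_le (setU11 a' J)) andTb Ek.
    by move: kJ; rewrite !inE => /orP [/eqP -> //|/CJ /andP [/ltnW]].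
  - by apply/forall_inP => k; rewrite !inE => /orP [/eqP -> //|/CJ /andP []].
case: ifP => [/forall_inP CJ|/forall_inPn [k kJ Ck]]; last first.
  by rewrite (bigD1 k) //= kJ (negPf Ck) mul0r mulr0.
have naJ : a' \notin J by apply/negP => /CJ; rewrite /C ltnn.
rewrite /set_weight cardsU1 naJ big_setU1 //= addKn mulrCA; congr (_ * _).
rewrite -big_mkcond -prodr_const -big_split /=; apply: eq_bigr => k kJ.
by rewrite CJ.
Qed.

End SetSum.

(** * Tableaux grouped by their box minima *)

Section MinFilling.

Variables (A : comNzRingType) (b : A) (X : nat -> A) (la f : seq nat).

Local Notation M := (maxentry f).
Local Notation r := (size la).

Lemma card_box : #|box la| = sumn la.
Proof.
rewrite card_tagged; congr sumn; apply: (@eq_from_nth _ 0%N).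
  by rewrite size_map size_enum_ord.
move=> i; rewrite size_map size_enum_ord => lt_i.
rewrite (nth_map (Ordinal lt_i)) ?size_enum_ord // card_ord.
by rewrite nth_enum_ord.
Qed.

Lemma box_eq (u v : box la) : row u = row v -> col u = col v -> u = v.
Proof.
case: u v => [i j] [i' j']; rewrite /row /col /= => /val_inj Ei.
by subst i' => /val_inj ->.
Qed.

Lemma box_exists i j : (i < r)%N -> (j < nth 0 la i)%N ->
  exists u : box la, row u = i /\ col u = j.
Proof. by move=> lt_i lt_j; exists (existT _ (Ordinal lt_i) (Ordinal lt_j)). Qed.

Lemma row_lt (u : box la) : (row u < r)%N.
Proof. exact: ltn_ord. Qed.

Lemma col_lt (u : box la) : (col u < nth 0 la (row u))%N.
Proof. exact: ltn_ord. Qed.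

(* Outside the diagram the entry is the junk value M, larger than all letters. *)
Definition entry (t : {ffun box la -> 'I_M.+1}) (i j : nat) : nat :=
  if [pick u : box la | (row u == i) && (col u == j)] is Some u then t u else M.

Lemma entry_box t (u : box la) : entry t (row u) (col u) = t u.
Proof.
rewrite /entry; case: pickP => [v /andP [/eqP Er /eqP Ec]|/(_ u)].
  by rewrite (box_eq Er Ec).
by rewrite !eqxx.
Qed.

Lemma entry_le t i j : (entry t i j <= M)%N.
Proof. by rewrite /entry; case: pickP => // u _; rewrite -ltnS. Qed.

Lemma entry_lt t i j : (entry t i j < M)%N ->
  exists u : box la, [/\ row u = i, col u = j & entry t i j = t u].
Proof.
rewrite /entry; case: pickP => [u /andP [/eqP Er /eqP Ec] _|_]; last by rewrite ltnn.
by exists u.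
Qed.

(** Conditions on a letter of the box [u] once the minima are prescribed by [t]. A missing neighbour
    has entry [M] and does not restrict the letters below [M]. *)
Definition compatible (t : {ffun box la -> 'I_M.+1}) (u : box la) : pred nat :=
  fun k => [&& (k < nth 0 f (row u))%N, (k <= entry t (row u) (col u).+1)%N
             & (k < entry t (row u).+1 (col u))%N].

Definition min_filling (T : filling la f) : {ffun box la -> 'I_M.+1} :=
  [ffun u => inord (setmin (T u))].

Lemma min_fillingE T u : min_filling T u = setmin (T u) :> nat.
Proof. by rewrite ffunE inordK // ltnS setmin_leq. Qed.

(** The tableau conditions compare the maximum of a box with the minimum of a neighbour. With all
    minima fixed they become conditions on single elements, independent from box to box. *)
Lemma is_FSVT_min (T : filling la f) t :
  is_FSVT T && (min_filling T == t) =
  [forall u, [&& T u != set0, setmin (T u) == t u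
               & [forall k in T u, compatible t u k]]].
Proof.
apply/andP/forallP => [[/and4P [T0 Tf Trow Tcol] /eqP <-] u|Tt].
  rewrite (forallP T0 u) min_fillingE eqxx /=; apply/forall_inP => k kT.
  rewrite /compatible (forall_inP (forallP Tf u)) //=.
  have le_k : (k <= setmax (T u))%N by rewrite /setmax (bigD1 k) //= leq_maxl.
  rewrite /entry; apply/andP; split.
    case: pickP => [v Pv|_]; last exact: ltnW.
    rewrite min_fillingE (leq_trans le_k) //.
    by have /forallP/(_ v)/implyP := forallP Trow u; apply.
  case: pickP => [v Pv|_]; last by [].
  rewrite min_fillingE (leq_ltn_trans le_k) //.
  by have /forallP/(_ v)/implyP := forallP Tcol u; apply.
have Tmin u : setmin (T u) = t u by case/and3P: (Tt u) => _ /eqP.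
have T0 u : T u != set0 by case/and3P: (Tt u).
have Tc u k : k \in T u -> compatible t u k.
  by case/and3P: (Tt u) => _ _ /forall_inP; apply.
split; last by apply/eqP/ffunP => u; apply: val_inj; rewrite /= min_fillingE Tmin.
apply/and4P; split; apply/forallP => u //.
- by apply/forall_inP => k /Tc /and3P [].
- apply/forallP => v; apply/implyP => /andP [/eqP Er /eqP Ec].
  rewrite Tmin; apply/bigmax_leqP => k /Tc /and3P [_ + _].
  by rewrite -Er -Ec entry_box.
- apply/forallP => v; apply/implyP => /andP [/eqP Er /eqP Ec].
  rewrite Tmin; have lt_t k : k \in T u -> (k < t v)%N.
    by move=> /Tc /and3P [_ _]; rewrite -Er -Ec entry_box.
  (* The box is non-empty, so [t v] is positive and the strict bound on the maximum becomes the weak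
     bound by [t v - 1], which can be checked elementwise. *)
  have [k kT _] := setmin_in (T0 u).
  have t_gt0 : (0 < t v)%N := leq_ltn_trans (leq0n k) (lt_t k kT).
  rewrite -(prednK t_gt0) ltnS; apply/bigmax_leqP => l /lt_t.
  by rewrite -{1}(prednK t_gt0).
Qed.

(** [G] over an arbitrary ring and family of variables; at [beta] and [x] it is convertible to
    [G]. *)
Definition tableau_sum : A :=
  \sum_(T : filling la f | is_FSVT T)
     b ^+ (\sum_u #|T u| - sumn la) * \prod_u \prod_(k in T u) X k.

Lemma tableau_sum_min :
  tableau_sum =
  \sum_(t : {ffun box la -> 'I_M.+1} |
      [forall u, (t u < M)%N && compatible t u (t u)])
    \prod_u (X (t u) *
      \prod_(k < M) (if (t u < k)%N && compatible t u k then 1 + b * X k else 1)).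
Proof.
transitivity (\sum_(T : filling la f | is_FSVT T) \prod_u set_weight b X (T u)).
  apply: eq_bigr => T /and4P [/forallP T0 _ _ _].
  rewrite big_split /=; congr (_ * _).
  (* As no box is empty, the total excess is the sum of the excesses of the boxes, without
     truncation. *)
  rewrite -card_box -sum1_card -sumnB; last by move=> u _; rewrite card_gt0 T0.
  by rewrite -prodrXr.
rewrite (partition_big min_filling xpredT) // [RHS]big_mkcond; apply: eq_bigr => t _.
rewrite -prod_if0; under eq_bigl do rewrite is_FSVT_min.
under [RHS]eq_bigr do rewrite -sum_sets_min.
by rewrite bigA_distr_big_dep; apply: eq_bigl => T; apply/forallP/familyP.
Qed.

End MinFilling.

Section Levels.

Variables (A : comNzRingType) (b : A) (X : nat -> A) (N : nat).

Definition level r M (mu : nat -> nat) (c : {ffun 'I_M -> {ffun 'I_r -> 'I_N}})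
    (m : nat) : nat -> nat :=
  fun_ext mu (fun k => shape_of (c k)) m.

Lemma level_top r M mu (c : {ffun 'I_M -> {ffun 'I_r -> 'I_N}}) :
  level mu c M = mu.
Proof. by rewrite /level fun_ext_out. Qed.

Lemma level_insert r M mu v (c : {ffun 'I_M -> {ffun 'I_r -> 'I_N}}) m :
  (m <= M)%N -> level mu (ffun_insert ord_max v c) m = level (shape_of v) c m.
Proof.
rewrite leq_eqVlt => /orP [/eqP ->|lt_m].
  rewrite level_top /level (fun_ext_lt _ _ (ltnSn M)) ffunE.
  by rewrite (_ : Ordinal _ = ord_max) ?unlift_none //; apply: val_inj.
rewrite /level (fun_ext_lt _ _ lt_m) (fun_ext_lt _ _ (ltnW lt_m : (m < M.+1)%N)) ffunE.
rewrite (_ : Ordinal _ = lift ord_max (Ordinal lt_m)) ?liftK //.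
by apply: val_inj; rewrite /= /bump leqNgt lt_m.
Qed.

Lemma chain_sum_levels r f M mu :
  chain_sum b N X r f M mu =
  \sum_(c : {ffun 'I_M -> {ffun 'I_r -> 'I_N}})
    (\prod_(i < r) (level mu c 0 i == 0%N)%:R) *
    \prod_(m < M) \prod_(i < r)
      step_weight b X (f i) m (level mu c m i) (level mu c m.+1 i) (level mu c m.+1 i.+1).
Proof.
elim: M mu => [|M IHM] mu.
  have L0 (c : {ffun 'I_0 -> {ffun 'I_r -> 'I_N}}) : level mu c 0 = mu.
    exact: level_top.
  under eq_bigr do rewrite L0 big_ord0 mulr1.
  by rewrite sumr_const card_ffun !card_ord expn0.
rewrite (sum_ffun_insert ord_max) /= /shape_sum; apply: eq_bigr => v _.
rewrite IHM mulr_sumr; apply: eq_bigr => c _.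
rewrite big_ord_recr /= level_top !level_insert // level_top mulrC -mulrA.
congr (_ * (_ * _)); apply: eq_bigr => m _; apply: eq_bigr => i _.
by rewrite !level_insert // ltnW.
Qed.

End Levels.

(** * Fillings by minima versus Gelfand-Tsetlin patterns *)

Section Patterns.

Variables (A : comNzRingType) (b : A) (X : nat -> A) (la f : seq nat) (N : nat).
Hypotheses (la_mono : forall i, (nth 0 la i.+1 <= nth 0 la i)%N)
  (la_lt : forall i, (nth 0 la i < N)%N).

Local Notation M := (maxentry f).
Local Notation r := (size la).
Local Notation filling_min := {ffun box la -> 'I_M.+1}.
Local Notation pattern := {ffun 'I_M -> {ffun 'I_r -> 'I_N}}.
Local Notation lev := (level (nth 0%N la)).

Definition valid_min (t : filling_min) : bool :=
  [forall u, (t u < M)%N && compatible t u (t u)].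

(* Gelfand-Tsetlin patterns of shape la, with flag f. *)
Definition is_pattern (c : pattern) : bool :=
  [forall i : 'I_r, lev c 0 i == 0%N] &&
  [forall m : 'I_M, forall i : 'I_r,
    [&& (lev c m.+1 i.+1 <= lev c m i)%N, (lev c m i <= lev c m.+1 i)%N
      & (m < nth 0 f i)%N || (lev c m i == lev c m.+1 i)]].

Definition linked (t : filling_min) (c : pattern) : Prop :=
  forall m i j, (m <= M)%N -> (entry t i j < m)%N = (j < lev c m i)%N.

Lemma level_out (c : pattern) m i : (r <= i)%N -> lev c m i = 0%N.
Proof.
move=> le_i; have [lt_m|le_m] := ltnP m M.
  by rewrite /level (fun_ext_lt _ _ lt_m) /shape_of fun_ext_out.
by rewrite /level fun_ext_out // nth_default.
Qed.

Lemma level_val (c : pattern) (m : 'I_M) (i : 'I_r) : lev c m i = c m i.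
Proof. by rewrite /level fun_ext_in /shape_of fun_ext_in. Qed.

Lemma entry_lt_M (t : filling_min) i j :
  (entry t i j < M)%N -> (j < nth 0 la i)%N.
Proof. by case/entry_lt=> u [<- <- _]; exact: col_lt. Qed.

Lemma linked_inj_l t t' c : linked t c -> linked t' c -> t = t'.
Proof.
move=> tc t'c; apply/ffunP => u; apply: val_inj; rewrite /= -!entry_box.
have E m : (m <= M)%N -> (entry t (row u) (col u) < m)%N = (entry t' (row u) (col u) < m)%N.
  by move=> le_m; rewrite tc ?t'c.
case: (ltngtP (entry t (row u) (col u)) (entry t' (row u) (col u))) => // lt_t.
  by have := E _ (entry_le t' (row u) (col u)); rewrite lt_t ltnn.
by have := E _ (entry_le t (row u) (col u)); rewrite lt_t ltnn.
Qed.

Lemma linked_inj_r t c c' : linked t c -> linked t c' -> c = c'.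
Proof.
move=> tc tc'; apply/ffunP => m; apply/ffunP => i; apply: val_inj.
rewrite /= -!level_val; have E j : (j < lev c m i)%N = (j < lev c' m i)%N.
  by rewrite -tc ?tc' // ltnW.
case: (ltngtP (lev c m i) (lev c' m i)) => // lt_c.
  by have := E (lev c m i); rewrite lt_c ltnn.
by have := E (lev c' m i); rewrite lt_c ltnn.
Qed.

Lemma valid_row t i j m : valid_min t -> (m <= M)%N ->
  (entry t i j.+1 < m)%N -> (entry t i j < m)%N.
Proof.
move=> /forallP t_ok le_m lt_m.
have lt_j := entry_lt_M (leq_trans lt_m le_m).
have lt_i : (i < r)%N by rewrite ltnNge; apply: contraTN lt_j => le_i; rewrite nth_default.
have [u [Ei Ej]] := box_exists lt_i (ltnW lt_j).
have /andP [_ /and3P [_ le_u _]] := t_ok u.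
by rewrite -Ei -Ej entry_box; apply: leq_ltn_trans le_u _; rewrite Ei Ej.
Qed.

Lemma valid_col t i j m : valid_min t -> (m < M)%N ->
  (entry t i.+1 j < m.+1)%N -> (entry t i j < m)%N.
Proof.
move=> /forallP t_ok lt_mM lt_m.
have lt_j := leq_trans (entry_lt_M (leq_trans lt_m lt_mM)) (la_mono i).
have lt_i : (i < r)%N by rewrite ltnNge; apply: contraTN lt_j => le_i; rewrite nth_default.
have [u [Ei Ej]] := box_exists lt_i lt_j.
have /andP [_ /and3P [_ _ lt_u]] := t_ok u.
by rewrite -Ei -Ej entry_box; apply: leq_trans lt_u _; rewrite Ei Ej -ltnS.
Qed.

(** The default ordinal is not reached for a valid filling, where each count is at most
    [nth 0 la i < N]. *)
Definition to_pattern (t : filling_min) : pattern :=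
  [ffun m : 'I_M => [ffun i : 'I_r =>
    insubd (Ordinal (la_lt 0)) #|[set j : 'I_N | (entry t i j < m)%N]|]].

Lemma linked_to_pattern t : valid_min t -> linked t (to_pattern t).
Proof.
move=> t_ok m i j; rewrite leq_eqVlt => /orP [/eqP ->|lt_m].
  rewrite level_top; apply/idP/idP => [/entry_lt_M//|lt_j].
  have lt_i : (i < r)%N by rewrite ltnNge; apply: contraTN lt_j => le_i; rewrite nth_default.
  have [u [<- <-]] := box_exists lt_i lt_j.
  by rewrite entry_box; case/andP: (forallP t_ok u).
have [lt_i|le_i] := ltnP i r; last first.
  rewrite level_out // ltn0; apply/negP => lt_e.
  by have := entry_lt_M (ltn_trans lt_e lt_m); rewrite nth_default.
have card_lt k : (k < #|[set j : 'I_N | (entry t i j < m)%N]|)%N = (entry t i k < m)%N.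
  apply: (@ltn_card_initial N (fun k => entry t i k < m)%N) => l.
    by apply: valid_row => //; exact: ltnW.
  by move=> lt_e; exact: ltn_trans (entry_lt_M (ltn_trans lt_e lt_m)) (la_lt i).
rewrite -card_lt (level_val _ (Ordinal lt_m) (Ordinal lt_i)) !ffunE val_insubd /=.
case: ifP => // /negP []; apply: leq_ltn_trans (la_lt i).
rewrite leqNgt card_lt; apply/negP => lt_e.
by have := entry_lt_M (ltn_trans lt_e lt_m); rewrite ltnn.
Qed.

Lemma pattern_step c m i : is_pattern c -> (m < M)%N -> (i < r)%N ->
  [&& (lev c m.+1 i.+1 <= lev c m i)%N, (lev c m i <= lev c m.+1 i)%N
      & (m < nth 0 f i)%N || (lev c m i == lev c m.+1 i)].
Proof.
move=> /andP [_ /forallP c_ok] lt_m lt_i.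
by have /forallP/(_ (Ordinal lt_i)) := c_ok (Ordinal lt_m).
Qed.

Lemma pattern0 c i : is_pattern c -> lev c 0 i = 0%N.
Proof.
move=> /andP [/forallP c0 _]; have [lt_i|le_i] := ltnP i r; last exact: level_out.
by have /eqP := c0 (Ordinal lt_i).
Qed.

Lemma pattern_le c m n i : is_pattern c -> (m <= n)%N -> (n <= M)%N ->
  (lev c m i <= lev c n i)%N.
Proof.
move=> c_ok le_mn; rewrite -(subnKC le_mn); elim: (n - m)%N => [|d IHd] le_n.
  by rewrite addn0.
rewrite addnS in le_n *; apply: leq_trans (IHd (ltnW le_n)) _.
have [lt_i|le_i] := ltnP i r; last by rewrite !level_out.
by case/and3P: (pattern_step c_ok le_n lt_i).
Qed.

(** The entry of a box is the number of letters after which the box is still absent. *)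
Definition to_filling (c : pattern) : filling_min :=
  [ffun u => inord #|[set m : 'I_M | (lev c m.+1 (row u) <= col u)%N]|].

Lemma linked_to_filling c : is_pattern c -> linked (to_filling c) c.
Proof.
move=> c_ok m i j le_m; have [lt_j|le_j] := ltnP j (nth 0 la i); last first.
  have -> : (j < lev c m i)%N = false.
    apply/negbTE; rewrite -leqNgt; apply: leq_trans le_j.
    by have := pattern_le i c_ok le_m (leqnn M); rewrite level_top.
  apply/negbTE/negP => lt_e; have := entry_lt_M (leq_trans lt_e le_m).
  by rewrite ltnNge le_j.
have lt_i : (i < r)%N by rewrite ltnNge; apply: contraTN lt_j => le_i; rewrite nth_default.
have [u [<- <-]] := box_exists lt_i lt_j.
rewrite entry_box ffunE inordK; last first.
  by rewrite ltnS; apply: leq_trans (max_card _) _; rewrite card_ord.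
case: m le_m => [_|m lt_m]; first by rewrite pattern0.
pose P k := (k < M)%N && (lev c k.+1 (row u) <= col u)%N.
have -> : [set m : 'I_M | (lev c m.+1 (row u) <= col u)%N] = [set m : 'I_M | P m].
  by apply/setP => k; rewrite !inE /P ltn_ord.
rewrite ltnS leqNgt ltn_card_initial /P => [|k /andP [lt_k le_c]|k /andP [] //].
  by rewrite lt_m -ltnNge.
by rewrite (ltnW lt_k) (leq_trans _ le_c) // pattern_le // ltnW.
Qed.

Lemma linked_valid t c : linked t c -> valid_min t -> is_pattern c.
Proof.
move=> tc t_ok; have le_lev m i m' i' : (m <= M)%N -> (m' <= M)%N ->
    (forall j, (entry t i j < m)%N -> (entry t i' j < m')%N) ->
    (lev c m i <= lev c m' i')%N.
  move=> le_m le_m' E; rewrite leqNgt; apply/negP => lt_c.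
  by have := E (lev c m' i'); rewrite !tc // ltnn lt_c => /(_ isT).
apply/andP; split; apply/forallP => m; first by rewrite -leqn0 leqNgt -tc.
have lt_m := ltn_ord m; have le_m := ltnW lt_m.
apply/forallP => i; apply/and3P; split.
- by apply: le_lev => // j; exact: (valid_col t_ok lt_m).
- by apply: le_lev => // j; exact: ltnW.
- have [//|le_f] := ltnP m (nth 0 f i); rewrite eqn_leq; apply/andP; split.
    by apply: le_lev => // j; exact: ltnW.
  apply: le_lev => // j lt_e.
  have [u [Ei Ej Eu]] := entry_lt (leq_trans lt_e lt_m).
  have /andP [_ /and3P [lt_f _ _]] := forallP t_ok u.
  by rewrite Eu; apply: leq_trans lt_f _; rewrite Ei.
Qed.

Lemma linked_pattern t c : linked t c -> is_pattern c -> valid_min t.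
Proof.
move=> tc c_ok; apply/forallP => u; set a := t u.
have Ea m : (m <= M)%N -> (a < m)%N = (col u < lev c m (row u))%N.
  by move=> le_m; rewrite -tc // entry_box.
have lt_a : (a < M)%N by rewrite Ea // level_top col_lt.
have la_a : (col u < lev c a (row u))%N = false by rewrite -Ea ?ltnn // ltnW.
have la_a1 : (col u < lev c a.+1 (row u))%N by rewrite -Ea.
have /and3P [le_col le_lev flag] := pattern_step c_ok lt_a (row_lt u).
rewrite lt_a andTb; apply/and3P; split.
- by case/orP: flag => // /eqP E; rewrite -E la_a in la_a1.
- rewrite leqNgt tc; last exact: ltnW.
  by apply/negP => /ltnW; rewrite la_a.
- rewrite ltnNge; apply/negP; rewrite -ltnS tc // => lt_c.
  by have := leq_trans lt_c le_col; rewrite la_a.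
Qed.

(** [linked] determines each side from the other, so the two constructions are mutually inverse. *)
Lemma sum_valid_pattern (F : filling_min -> A) (F' : pattern -> A) :
  (forall t c, linked t c -> is_pattern c -> F t = F' c) ->
  \sum_(t | valid_min t) F t = \sum_(c | is_pattern c) F' c.
Proof.
move=> EF; rewrite (reindex_onto to_filling to_pattern) /=.
  have to_fillingK c : is_pattern c -> to_pattern (to_filling c) = c.
    move=> c_ok; have tc := linked_to_filling c_ok.
    exact: (linked_inj_r (linked_to_pattern (linked_pattern tc c_ok)) tc).
  apply: eq_big => [c|c /andP [t_ok /eqP Ec]].
    apply/andP/idP => [[t_ok /eqP Ec]|c_ok].
      by rewrite -Ec; exact: linked_valid (linked_to_pattern t_ok) t_ok.
    rewrite to_fillingK ?eqxx //.
    by split=> //; exact: linked_pattern (linked_to_filling c_ok) c_ok.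
  apply: EF; last by rewrite -Ec; exact: linked_valid (linked_to_pattern t_ok) t_ok.
  by rewrite -{2}Ec; exact: linked_to_pattern.
move=> t t_ok; have tc := linked_to_pattern t_ok.
exact: linked_inj_l (linked_to_filling (linked_valid tc t_ok)) tc.
Qed.

Definition level_weight (c : pattern) m i : A :=
  X m ^+ (lev c m.+1 i - lev c m i) *
  (if (m < nth 0 f i)%N && (lev c m.+1 i.+1 < lev c m i)%N then 1 + b * X m else 1).

Lemma prod_boxes (F : nat -> nat -> A) :
  \prod_(u : box la) F (row u) (col u) =
  \prod_(i < r) \prod_(j < nth 0 la i) F i j.
Proof. by rewrite (sig_big_dep _ _ (fun (i : 'I_r) (j : 'I_(nth 0%N la i)) => F i j)). Qed.

(** In row [i] the letter [m] is the minimum of the boxes added between the levels [m] and [m + 1].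
    As an additional entry it fits, below the flag, only into the last box of level [m], and only if
    the box beneath is not in level [m + 1]. *)
Lemma filling_weight t c : linked t c -> is_pattern c ->
  \prod_u (X (t u) * \prod_(k < M)
     (if (t u < k)%N && compatible t u k then 1 + b * X k else 1)) =
  \prod_(m < M) \prod_(i < r) level_weight c m i.
Proof.
move=> tc c_ok.
pose F i j := X (entry t i j) * \prod_(k < M)
  (if [&& (entry t i j < k)%N, (k < nth 0 f i)%N, (k <= entry t i j.+1)%N
        & (k < entry t i.+1 j)%N] then 1 + b * X k else 1).
transitivity (\prod_(u : box la) F (row u) (col u)).
  by apply: eq_bigr => u _; rewrite /F entry_box.
rewrite prod_boxes exchange_big; apply: eq_bigr => i _ /=.
have le_la m : (m <= M)%N -> (lev c m i <= nth 0 la i)%N.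
  by move=> le_m; have := pattern_le i c_ok le_m (leqnn M); rewrite level_top.
rewrite !big_split /=; congr (_ * _).
  transitivity (\prod_(j < nth 0 la i) \prod_(m < M)
      (if (lev c m i <= j < lev c m.+1 i)%N then X m else 1)).
    apply: eq_bigr => j _; have lt_e : (entry t i j < M)%N by rewrite tc // level_top.
    rewrite (bigD1 (Ordinal lt_e)) //= big1 ?mulr1 => [|m ne_m].
      by rewrite leqNgt -!tc ?ltnn ?ltnSn // ltnW.
    case: ifP => // /andP []; rewrite leqNgt -!tc // -?leqNgt ?ltnS => [le_m ge_m|].
      by case/eqP: ne_m; apply: val_inj; apply/eqP; rewrite eqn_leq le_m ge_m.
    exact: ltnW.
  rewrite exchange_big; apply: eq_bigr => m _.
  by rewrite prod_window // le_la.
rewrite exchange_big; apply: eq_bigr => m _ /=.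
have lt_m := ltn_ord m; have le_m := ltnW lt_m.
(* The columns that may receive [m] form a window with at most one element, so the product over the
   columns is a power with exponent 0 or 1. *)
rewrite [RHS](_ : _ = (1 + b * X m) ^+ (lev c m i -
    (if (m < nth 0 f i)%N then maxn (lev c m i).-1 (lev c m.+1 i.+1) else lev c m i))).
  rewrite -(prod_window _ _ (le_la m le_m)); apply: eq_bigr => j _.
  congr (if _ then _ else _); rewrite tc // [(m <= _)%N]leqNgt tc //.
  rewrite [(m < entry _ _ _)%N]leqNgt -ltnS tc //.
  move: (lev c m i) (lev c m.+1 i.+1) (nat_of_ord j) => p q l.
  by case: (m < nth 0 f i)%N => /=; clear; lia.
case: (m < nth 0 f i)%N; last by rewrite subnn.
case: ltnP => lt_c /=.
  by rewrite (_ : (_ - _)%N = 1%N) ?expr1 //; lia.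
by rewrite (_ : (_ - _)%N = 0%N) ?expr0 //; lia.
Qed.

Lemma chain_sum_patterns :
  chain_sum b N X r (nth 0 f) M (nth 0 la) =
  \sum_(c | is_pattern c) \prod_(m < M) \prod_(i < r) level_weight c m i.
Proof.
rewrite chain_sum_levels [RHS]big_mkcond; apply: eq_bigr => c _.
have E0 : \prod_(i < r) (lev c 0 i == 0%N)%:R =
    (if [forall i : 'I_r, lev c 0 i == 0%N] then 1 else 0 : A).
  transitivity (\prod_(i < r) (if lev c 0 i == 0%N then 1 else 0 : A)).
    by apply: eq_bigr => i _; case: eqP.
  by rewrite prod_if0 big1_eq.
have E1 : \prod_(m < M) \prod_(i < r)
    step_weight b X (nth 0 f i) m (lev c m i) (lev c m.+1 i) (lev c m.+1 i.+1) =
  if [forall m : 'I_M, forall i : 'I_r, [&& (lev c m.+1 i.+1 <= lev c m i)%N,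
    (lev c m i <= lev c m.+1 i)%N & (m < nth 0 f i)%N || (lev c m i == lev c m.+1 i)]]
  then \prod_(m < M) \prod_(i < r) level_weight c m i else 0.
  rewrite -prod_if0; apply: eq_bigr => m _; rewrite -prod_if0.
  by apply: eq_bigr => i _.
rewrite E0 E1 /is_pattern; case: ifP => _; last by rewrite mul0r.
by rewrite mul1r.
Qed.

Lemma tableau_sum_chain_sum : tableau_sum b X la f = chain_sum b N X r (nth 0 f) M (nth 0 la).
Proof.
rewrite tableau_sum_min chain_sum_patterns.
exact: (sum_valid_pattern (@filling_weight)).
Qed.

End Patterns.

(** * Assembling the theorem *)

Lemma partition_nth_mono la i : is_partition la -> (nth 0 la i.+1 <= nth 0 la i)%N.
Proof.
move=> /andP [la_sorted _]; have [lt_i|le_i] := ltnP i.+1 (size la); last first.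
  by rewrite nth_default.
exact: (sortedP _ la_sorted).
Qed.

Lemma partition_nth_le la i : is_partition la -> (nth 0 la i <= nth 0 la 0)%N.
Proof.
by move=> hla; elim: i => // i; apply: leq_trans; apply: partition_nth_mono.
Qed.

Lemma nth_le_maxentry f i : (i < size f)%N -> (nth 0 f i <= maxentry f)%N.
Proof.
by move=> lt_i; rewrite /maxentry (big_nth 0%N) big_mkord (bigD1 (Ordinal lt_i)) //= leq_maxl.
Qed.

Theorem theorem3p3 (la f : seq nat)
  (hla : is_partition la) (hf : is_flagging la f)
  (hfle : forall i : nat, (i < size la)%N -> (i.+1 <= nth 0%N f i)%N)
  (hf1 : nth 0%N f 0 = 1%N -> (1 < size la)%N -> (1 < nth 0%N f 1)%N) :
  G la f =
  pi_perm (word_perm (flag_word f))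
    (\prod_(i < size la) x i ^+ (nth 0%N la i + nth 0%N f i - i.+1)).
Proof.
have /and3P [/eqP size_f f_sorted _] := hf.
(* Rows are longer while their flags are lower, so the bound on parts must cover [la i + f i] and
   not only [la i]. *)
pose N := (nth 0%N la 0 + maxentry f).+1.
have la_mono i := partition_nth_mono i hla.
have la_lt i : (nth 0%N la i < N)%N.
  by rewrite ltnS (leq_trans (partition_nth_le i hla)) ?leq_addr.
have x0 : x = shifted_x 0.
  by apply: functional_extensionality => j; rewrite /shifted_x addn0.
have f_mono i : (i.+1 < size la)%N -> (nth 0%N f i <= nth 0%N f i.+1)%N.
  by move=> lt_i; apply: (sortedP _ f_sorted); rewrite size_f.
have f_le i : (i < size la)%N -> (nth 0%N f i <= maxentry f)%N.
  by move=> lt_i; apply: nth_le_maxentry; rewrite size_f.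
have laN i : (i < size la)%N -> (nth 0%N la i + nth 0%N f i <= N)%N.
  by move=> lt_i; rewrite ltnW // ltnS leq_add ?partition_nth_le ?f_le.
have la0 i : (size la <= i)%N -> nth 0%N la i = 0%N by exact: nth_default.
rewrite flag_word_run_word pi_perm_run_word size_f.
apply: etrans (congr1 (fun X => tableau_sum beta X la f) x0) _.
apply: etrans (tableau_sum_chain_sum beta (shifted_x 0) f la_mono la_lt) _.
apply: etrans (chain_sum_pi_word 0 (ltn0Sn _) hfle f_mono f_le laN la_mono la0) _.
apply: (f_equal2 pi_word); first by [].
by apply: eq_bigr => i _; apply: (f_equal2 (@GRing.exp _)); rewrite ?addn0.
Qed.
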